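(* Let $\mathbb{G}$ be a connected ribbon graph. The genus of $\mathbb{G}$ gives an upper bound on the homological width of $\widetilde{Kh}(\mathbb{G})$; in particular $$hw(\widetilde{Kh}(\mathbb{G}))\leq g(\mathbb{G})+1.$$
   Context: **Ribbon graphs.** A ribbon graph $\mathbb{G}$ (always oriented) is a finite nonempty graph (loops and multiple edges allowed) together with an embedding into a closed oriented surface $\Sigma$ whose complement is a disjoint union of open disks; equivalently, a graph with a cyclic order of the half-edges at each vertex. The genus $g(\mathbb{G})$ is the genus of $\Sigma$. $\Sigma_{\mathbb{G}}$ is a regular neighborhood of $\mathbb{G}$ in $\Sigma$: one disk per vertex and one band per edge. $F(\mathbb{G})$ is the set of boundary components of $\Sigma_{\mathbb{G}}$. A spanning ribbon subgraph $\mathbb{H}$ has the same vertices, a subset of the edges, and inherited cyclic orders; it has its own surface $\Sigma_{\mathbb{H}}$ and set $F(\mathbb{H})$. **Bigraded groups.** For a bigraded abelian group $M$ ($i$ homological, $j$ polynomial grading), $(M[r]\{s\})^{i,j}=M^{i-r,j-s}$. $V$ is free abelian on $v_+,v_-$ in bigradings $(0,1),(0,-1)$. Define $m:V\otimes V\to V$ by $v_+\otimes v_+\mapsto v_+$, $v_+\otimes v_-\mapsto v_-$, $v_-\otimes v_+\mapsto v_-$, $v_-\otimes v_-\mapsto 0$, and $\Delta:V\to V\otimes V$ by $v_+\mapsto v_+\otimes v_-+v_-\otimes v_+$, $v_-\mapsto v_-\otimes v_-$. **Khovanov homology of a ribbon graph.** Let $\mathbb{G}$ have edges $e_1,\dots,e_n$.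 For $I=(m_1,\dots,m_n)\in\{0,1\}^n$ let $h(I)=\sum m_i$, let $\mathbb{G}(I)$ be the spanning ribbon subgraph with edge set $\{e_i: m_i=1\}$, and $V(\mathbb{G}(I))=V^{\otimes F(\mathbb{G}(I))}[h(I)]\{h(I)\}$. $CKh(\mathbb{G})=\bigoplus_I V(\mathbb{G}(I))$. If $J$ is obtained from $I$ by changing the $k$th coordinate from $0$ to $1$ (a hypercube edge $\xi:I\to J$), adding the band of $e_k$ merges two boundary components or splits one into two; $d_\xi$ is $m$ (merge) or $\Delta$ (split) on the affected factors and the identity on the others. The differential is $d=\sum_\xi(-1)^{|\{i<k:\,m_i=1\}|}d_\xi$; it raises $i$ by 1 and preserves $j$. Reduced version: fix a marked point on the boundary of a vertex disk of $\Sigma_{\mathbb{G}}$ away from all bands; each $\Sigma_{\mathbb{G}(I)}$ has a unique boundary component containing it. $\widetilde{CKh}(\mathbb{G})$ is the subcomplex of $CKh(\mathbb{G})$ in which the factor of the marked component is $\mathbb{Z}v_-$, with polynomial grading shifted up by $1$; $\widetilde{Kh}(\mathbb{G})=\bigoplus\widetilde{Kh}^{i,j}(\mathbb{G})$ is its homology. **Homological width.** The diagonal grading is $\delta=j/2-i$, and $\widetilde{Kh}^{\delta}(\mathbb{G})$ is the summand of $\widetilde{Kh}(\mathbb{G})$ in diagonal grading $\delta$. With $\delta_{\max}(\mathbb{G})$ and $\delta_{\min}(\mathbb{G})$ the maximum and minimum $\delta$ for which $\widetilde{Kh}^\delta(\mathbb{G})\ne0$, $hw(\widetilde{Kh}(\mathbb{G}))=\delta_{\max}(\mathbb{G})-\delta_{\min}(\mathbb{G})+1$.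 *)

(* Defs.v *)
From mathcomp Require Import all_boot all_order all_fingroup all_algebra.
From mathcomp Require classical_sets.

Set Implicit Arguments.
Unset Strict Implicit.
Unset Printing Implicit Defensive.

Import Order.TTheory GRing.Theory Num.Theory.

Local Open Scope ring_scope.

(* An oriented ribbon graph with edges e_0, ..., e_(n-1).  The edge e has the
   two half-edges (e, false) and (e, true); [rot h] is the half-edge following
   h counterclockwise around its vertex, so the half-edges at a vertex with at
   least one half-edge form exactly one cycle of [rot].  Vertices without
   half-edges are allowed. *)
Record ribbonGraph := RibbonGraph {
  vertex : finType;
  nedges : nat;
  src : 'I_nedges * bool -> vertex;
  rot : {perm 'I_nedges * bool};
  vertex_gt0 : (0 < #|vertex|)%N;
  rotP : forall h k, (src h == src k) = (k \in porbit rot h)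
}.

Section RibbonGraph.
Variable G : ribbonGraph.

Local Notation edge := 'I_(nedges G).
Local Notation hedge := ('I_(nedges G) * bool)%type.

Definition adjacent (u v : vertex G) : bool :=
  [exists h : hedge, (src h == u) && (src (h.1, ~~ h.2) == v)].

Definition connected : Prop := forall u v : vertex G, connect adjacent u v.

(* A corner is a component of the boundary of the vertex disks with the ends of
   all the bands of G removed: [inl h] is the arc going counterclockwise from
   the half-edge h to [rot h], and [inr v] is the whole boundary circle of the
   disk of an isolated vertex v. *)
Definition corner : Type :=
  (hedge + {v : vertex G | v \notin codom (@src G)})%type.

Implicit Type A : {set edge}.

(* A stands for the spanning ribbon subgraph with edge set A. *)
Definition flip A (h : hedge) : hedge :=
  if h.1 \in A then (h.1, ~~ h.2) else h.

(* The boundary of the surface of A, followed with the vertex disks on its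
   left.  After the arc [inl h] one meets the end of [rot h].  If its band is
   absent, one goes on along the disk to the next arc; if it is present, one
   goes along the side of the band, which by orientability leads to the arc
   just after the opposite half-edge. *)
Definition next_corner A (c : corner) : corner :=
  match c with
  | inl h => inl (flip A (rot G h))
  | inr v => inr v
  end.

Lemma flipK A : involutive (flip A).
Proof.
move=> [e b]; rewrite /flip /=; case eA: (e \in A) => /=; last by rewrite eA.
by rewrite eA negbK.
Qed.

Lemma next_corner_inj A : injective (next_corner A).
Proof.
move=> [h|v] [k|w] //= [].
by move/(can_inj (flipK A))/perm_inj->.
Qed.

Definition boundary A : {perm corner} := perm (@next_corner_inj A).

(* F(A), each boundary component being given by the corners it contains *)
Definition bcomps A : {set {set corner}} := porbits (boundary A).

(* The genus of the closed surface obtained by capping off the surface of G,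
   from its Euler characteristic 2 k - 2 g, with k the number of components. *)
Definition euler_char : rat :=
  #|vertex G|%:R - (nedges G)%:R + #|bcomps setT|%:R.

Definition genus : rat :=
  ((n_comp adjacent predT).*2%:R - euler_char) / 2.

(* The standard basis of CKh(G), the direct sum over A of the tensor powers
   of V indexed by F(A): a pair (A, X) with X a subset of F(A) is the pure
   tensor with factor v_+ at the components in X and v_- at the others. *)
Definition state : Type :=
  {S : {set edge} * {set {set corner}} | S.2 \subset bcomps S.1}.

Definition edges_of (s : state) : {set edge} := (val s).1.
Definition comps_of (s : state) : {set {set corner}} := bcomps (edges_of s).
Definition plus_of (s : state) : {set {set corner}} := (val s).2.

(* the label of a component, true for v_+ and false for v_- *)
Definition label (s : state) (C : {set corner}) : bool := C \in plus_of s.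

Definition hdeg (s : state) : int := #|edges_of s|%:Z.

Definition qdeg (s : state) : int :=
  #|plus_of s|%:Z - #|comps_of s :\: plus_of s|%:Z + #|edges_of s|%:Z.

(* the coefficient of z in m (x (x) y) *)
Definition m_coef (x y z : bool) : int :=
  match x, y with
  | true, true => (z == true)%:R
  | true, false => (z == false)%:R
  | false, true => (z == false)%:R
  | false, false => 0
  end.

(* the coefficient of y (x) z in Delta x *)
Definition Delta_coef (x y z : bool) : int :=
  match x with
  | true => ((y == true) && (z == false))%:R
            + ((y == false) && (z == true))%:R
  | false => ((y == false) && (z == false))%:R
  end.

(* The coefficient of t in d_xi s, for xi the hypercube edge from
   [edges_of s] to [edges_of t].  The components not affected by the new band
   are those belonging to both sets of components.  The enumeration order is
   irrelevant since m is commutative and Delta cocommutative, and the last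
   case of the match does not occur for a hypercube edge. *)
Definition edge_coef (s t : state) : int :=
  if [forall C in comps_of s :&: comps_of t, label s C == label t C] then
    match enum (comps_of s :\: comps_of t), enum (comps_of t :\: comps_of s) with
    | [:: C1; C2], [:: D] => m_coef (label s C1) (label s C2) (label t D)
    | [:: C], [:: D1; D2] => Delta_coef (label s C) (label t D1) (label t D2)
    | _, _ => 0
    end
  else 0.

Definition d_coef (s t : state) : int :=
  \sum_(e | (e \notin edges_of s) && (edges_of t == e |: edges_of s))
     (-1) ^+ #|[set i in edges_of s | (i < e)%N]| * edge_coef s t.

Definition chain : Type := {ffun state -> int}.

Definition differential (x : chain) : chain :=
  [ffun t => \sum_s x s * d_coef s t].

Section Reduced.

(* the corner containing the marked point *)
Variable p : corner.

Definition marked_comp (s : state) : {set corner} :=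
  porbit (boundary (edges_of s)) p.

(* x is in bidegree (i, j) of the reduced complex, whose polynomial grading is
   that of CKh(G) shifted up by 1 *)
Definition reduced_chain (i j : int) (x : chain) : Prop :=
  forall s, x s != 0 ->
    [/\ ~~ label s (marked_comp s), hdeg s = i & qdeg s + 1 = j].

Definition reduced_cycle (i j : int) (x : chain) : Prop :=
  reduced_chain i j x /\ differential x = 0.

Definition reduced_boundary (i j : int) (x : chain) : Prop :=
  exists2 y, reduced_chain (i - 1) j y & differential y = x.

(* the quotient of cycles by boundaries in bidegree (i, j) is nonzero *)
Definition reduced_Kh_neq0 (i j : int) : Prop :=
  exists2 x, reduced_cycle i j x & ~ reduced_boundary i j x.

(* the summand in diagonal grading delta = j / 2 - i is nonzero *)
Definition reduced_Kh_delta_neq0 (delta : rat) : Prop :=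
  exists i j : int, delta = j%:~R / 2 - i%:~R /\ reduced_Kh_neq0 i j.

Definition is_delta_max (delta : rat) : Prop :=
  reduced_Kh_delta_neq0 delta /\
  forall delta', reduced_Kh_delta_neq0 delta' -> delta' <= delta.

Definition is_delta_min (delta : rat) : Prop :=
  reduced_Kh_delta_neq0 delta /\
  forall delta', reduced_Kh_delta_neq0 delta' -> delta <= delta'.

(* The complex is finitely generated, so the default 0 is taken only if the
   whole reduced homology vanishes. *)
Definition delta_max : rat := classical_sets.xget 0 is_delta_max.
Definition delta_min : rat := classical_sets.xget 0 is_delta_min.

Definition hw : rat := delta_max - delta_min + 1.

End Reduced.

End RibbonGraph.

(* Main.v *)
Require Import Defs.
From mathcomp Require Import all_boot all_order all_fingroup all_algebra.
From mathcomp Require Import zify ring lra.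
From mathcomp Require boolp classical_sets.

Set Implicit Arguments.
Unset Strict Implicit.
Unset Printing Implicit Defensive.

Import Order.TTheory GRing.Theory Num.Theory.

Local Open Scope ring_scope.

(** Call an edge set A a quasi-tree if its surface has a single boundary
    component.  The only reduced state over A then has 2 delta = - |A|, and the
    theorem follows from two facts.

    First, reduced homology lives only in the diagonal gradings - |A| / 2 of
    quasi-trees A.  This is the spanning quasi-tree model, proved here in the
    form of a vanishing statement ([exact_part]) by induction on intervals
    A0 <= A <= A1 of the cube of resolutions that contain a quasi-tree.  If some
    free edge e belongs to some quasi-trees of the interval but not to all of
    them, the complex is an extension of the complexes of two smaller intervals,
    both with quasi-trees ([exact_at_filtration]).  Otherwise the interval has a
    unique quasi-tree T, and toggling a free edge e of T cuts its boundary circle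
    in two.  By uniqueness these cuts do not cross, so a free edge whose lobe (the
    part without the marked point) is smallest cuts off a leaf that no other free
    edge touches ([exists_leaf]).  As in the invariance under the first
    Reidemeister move, the map of e then cancels the states in which e has its
    value in T against those in which e has the other value and the leaf has one
    of its two labels: for a split, x goes to x (x) v_- plus terms with v_+ on
    the leaf, and for a merge, x (x) v_+ goes to x ([exact_at_cone]).  There
    remain the states in which the leaf carries the other label for good; they
    form the same kind of complex, with one free edge less and one frozen
    component more, and the expected value of delta is the same.

    Second, adding or removing one band changes the number of boundary components
    by one.  Comparing a quasi-tree A with the empty edge set, whose surface has
    one boundary component per vertex, gives |V| - 1 <= |A|; comparing it with
    the full edge set gives |A| <= |E| + 1 - |F(G)|.  By Euler's formula the
    difference of the two bounds is twice the genus ([quasi_tree_genus]).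

    Passing to subquotient complexes uses that the differential squares to zero
    ([d_coef_d_coef]).  Let R be the ring generated by one variable of square zero
    for each corner.  The tensor power V(A) is the quotient of R that identifies
    the variables of corners on the same boundary component, v_+ being 1 and v_-
    the variable.  A merge is then the projection between quotients and a split is
    multiplication by the sum of the variables of the two sides of the band.  As
    these maps are R-linear, it is enough to compare, on each face of the cube, the
    two products of such factors ([face_factors]). *)

(** * Cycles of a permutation times a transposition *)

Section Stable.

Variable T : finType.
Implicit Types (s : {perm T}) (C W : {set T}) (x y z : T).

Definition stable s W := forall c, (s c \in W) = (c \in W).

Lemma stable_porbit s x : stable s (porbit s x).
Proof.
by move=> c; have := porbit_perm s 1 c; rewrite expg1 -!eq_porbit_mem => ->.
Qed.

Lemma stableU s W1 W2 : stable s W1 -> stable s W2 -> stable s (W1 :|: W2).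
Proof. by move=> h1 h2 c; rewrite !inE h1 h2. Qed.

Lemma stableD s W1 W2 : stable s W1 -> stable s W2 -> stable s (W1 :\: W2).
Proof. by move=> h1 h2 c; rewrite !inE h1 h2. Qed.

Lemma stable_mul_tperm s W x y :
  (x \in W) = (y \in W) -> stable s W -> stable (s * tperm x y)%g W.
Proof.
by move=> xy sW c; rewrite permM -(sW c); case: tpermP => // ->; rewrite xy.
Qed.

Lemma porbit_sub s W x : stable s W -> x \in W -> porbit s x \subset W.
Proof.
move=> sW xW; apply/subsetP=> y /porbitP[i ->].
by elim: i => [|i IHi]; rewrite ?perm1 // expgSr permM sW.
Qed.

Lemma mul_tpermK s x y : (s * tperm x y * tperm x y)%g = s.
Proof. by rewrite -mulgA tperm2 mulg1. Qed.

Lemma card_porbits_mul_tperm s x y : x != y ->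
  (#|porbits (s * tperm x y)%g| + (y \notin porbit s x).*2
   = #|porbits s|.+1)%N.
Proof.
move=> xy; rewrite -porbitsV invMg tpermV -[in RHS]porbitsV.
have := porbits_mul_tperm s^-1%g x y.
by rewrite /= porbitV porbit_sym xy addn1.
Qed.

(** The previous count applies to [s] and to its product with the transposition,
    and the two resulting equations rule out every other case. *)
Lemma mem_porbit_mul_tperm s x y : x != y ->
  (y \in porbit (s * tperm x y)%g x) = (y \notin porbit s x).
Proof.
move=> xy; have := card_porbits_mul_tperm s xy.
have := card_porbits_mul_tperm (s * tperm x y)%g xy.
by rewrite mul_tpermK; case: (y \in porbit s x); case: (y \in porbit _ x) => //=; lia.
Qed.

(** Both sides contain x and y, hence are stable under both permutations. *)
Lemma porbit_mul_tperm_merge s x y : y \notin porbit s x ->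
  porbit (s * tperm x y)%g x = porbit s x :|: porbit s y.
Proof.
move=> yx; have xy : x != y by apply: contraNneq yx => ->; exact: porbit_id.
have yx' : y \in porbit (s * tperm x y)%g x by rewrite mem_porbit_mul_tperm.
apply/eqP; rewrite eqEsubset; apply/andP; split.
  apply: porbit_sub; last by rewrite inE porbit_id.
  apply: stable_mul_tperm; last by apply: stableU; exact: stable_porbit.
  by rewrite !inE !porbit_id orbT.
have st : stable s (porbit (s * tperm x y)%g x).
  rewrite -{1}(mul_tpermK s x y); apply: stable_mul_tperm.
    by rewrite porbit_id yx'.
  exact: stable_porbit.
by rewrite subUset !porbit_sub // porbit_id.
Qed.

Lemma porbit_mul_tperm_id s x y z : x \notin porbit s z -> y \notin porbit s z ->
  porbit (s * tperm x y)%g z = porbit s z.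
Proof.
move=> xz yz; apply/eqP; rewrite eqEsubset; apply/andP.
have sub : porbit (s * tperm x y)%g z \subset porbit s z.
  apply: porbit_sub (porbit_id _ _); apply: stable_mul_tperm (stable_porbit _ _).
  by rewrite (negbTE xz) (negbTE yz).
split=> //; apply: porbit_sub (porbit_id _ _).
rewrite -{1}(mul_tpermK s x y); apply: stable_mul_tperm (stable_porbit _ _).
by rewrite !(contraNF (subsetP sub _)).
Qed.

Lemma eq_porbit_on s s' D x : stable s D -> x \in D ->
  {in D, s =1 s'} -> porbit s' x = porbit s x.
Proof.
move=> sD xD ss'.
have eqi i : ((s' ^+ i) x)%g = ((s ^+ i) x)%g /\ ((s ^+ i) x)%g \in D.
  elim: i => [|i [IH1 IH2]]; first by rewrite !perm1.
  by rewrite !expgSr !permM IH1 sD ss'.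
by apply/setP=> y; apply/porbitP/porbitP=> -[i ->]; exists i; case: (eqi i).
Qed.

Lemma mem_porbits s x : porbit s x \in porbits s.
Proof. exact: imset_f. Qed.

Lemma porbits_eq s C x : C \in porbits s -> x \in C -> C = porbit s x.
Proof.
by case/imsetP=> z _ -> xz; apply/eqP; rewrite eq_sym eq_porbit_mem.
Qed.

Lemma mem_porbits_eq s C x : x \in C -> (C \in porbits s) = (C == porbit s x).
Proof.
by move=> xC; apply/idP/eqP=> [/porbits_eq|->]; [exact|exact: mem_porbits].
Qed.

Section Merge.

Variables (s : {perm T}) (x y : T).
Hypothesis yx : y \notin porbit s x.
Let s' := (s * tperm x y)%g.

Lemma porbits_merge : porbits s' :\: porbits s = [set porbit s' x].
Proof.
have eU := porbit_mul_tperm_merge yx; rewrite -/s' in eU.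
apply/setP=> C; rewrite !inE.
apply/andP/eqP=> [[nC /imsetP[z _ eC]]|->]; last first.
  split; last exact: mem_porbits.
  apply/negP=> h; have e := porbits_eq h (porbit_id _ _).
  by move: yx; rewrite -e eU !inE porbit_id orbT.
rewrite eC; apply/eqP; rewrite eq_porbit_mem; apply: contraNT nC => nz.
suff -> : C = porbit s z by exact: mem_porbits.
rewrite eC; apply: porbit_mul_tperm_id.
  by apply: contraNN nz; rewrite eU inE porbit_sym => ->.
by apply: contraNN nz; rewrite eU inE (porbit_sym s y) => ->; rewrite orbT.
Qed.

Lemma porbits_unmerge :
  porbits s :\: porbits s' = [set porbit s x; porbit s y].
Proof.
have eU := porbit_mul_tperm_merge yx; rewrite -/s' in eU.
have notin z : z \in porbit s' x -> porbit s z \notin porbits s'.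
  move=> zx; apply/negP=> h; have e := porbits_eq h (porbit_id _ _).
  have ez : porbit s' z = porbit s' x by apply/eqP; rewrite eq_porbit_mem.
  move: yx; rewrite -eq_porbit_mem.
  have e1 : porbit s x = porbit s z.
    by apply/eqP; rewrite eq_porbit_mem e ez porbit_id.
  suff -> : porbit s y = porbit s z by rewrite e1 eqxx.
  by apply/eqP; rewrite eq_porbit_mem e ez eU inE porbit_id orbT.
apply/setP=> C; rewrite !inE.
apply/andP/orP=> [[nC /imsetP[z _ eC]]|].
  case: (boolP (x \in porbit s z)) => xz.
    by left; rewrite eC eq_porbit_mem porbit_sym.
  case: (boolP (y \in porbit s z)) => yz.
    by right; rewrite eC eq_porbit_mem porbit_sym.
  by case/negP: nC; rewrite eC -(porbit_mul_tperm_id xz yz) mem_porbits.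
case=> /eqP->; split; rewrite ?mem_porbits //; apply: notin.
  exact: porbit_id.
by rewrite eU inE porbit_id orbT.
Qed.

End Merge.

End Stable.

(** * Complexes with a finite basis *)

Section BasedComplex.

Variables (T : finType) (dm : T -> T -> int) (hd qd : T -> int).

Hypothesis dm_dm : forall s u, \sum_t dm s t * dm t u = 0.
Hypothesis dm_hd : forall s t, dm s t != 0 -> hd t = hd s + 1.
Hypothesis dm_qd : forall s t, dm s t != 0 -> qd t = qd s.

Implicit Types (X Y U S : pred T) (y z : {ffun T -> int}) (i j : int).

Definition bd z (t : T) : int := \sum_s z s * dm s t.

(** A convex set of generators spans a subquotient complex: the part of [dm]
    inside it still squares to zero. *)
Definition convex X := forall s r t,
  X s -> X t -> dm s r != 0 -> dm r t != 0 -> X r.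

(** [hd] is the homological degree, raised by [dm], and [qd] a second degree that
    [dm] preserves. *)
Definition homog X i j z := forall s, z s != 0 -> [/\ X s, hd s = i & qd s = j].

Definition exact_at X i j := forall z, homog X i j z ->
  (forall t, X t -> bd z t = 0) ->
  exists2 y, homog X (i - 1) j y & forall t, X t -> bd y t = z t.

Lemma homog0 X i j z s : homog X i j z -> ~~ X s -> z s = 0.
Proof. by move=> hz; apply: contraNeq => /hz[]. Qed.

Lemma bdD y z t : bd (y + z) t = bd y t + bd z t.
Proof.
by rewrite /bd -big_split; apply: eq_bigr => s _; rewrite ffunE mulrDl.
Qed.

Lemma bdB y z t : bd (y - z) t = bd y t - bd z t.
Proof.
rewrite bdD /bd -sumrN; congr (_ + _).
by apply: eq_bigr => s _; rewrite ffunE mulNr.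
Qed.

Lemma homogD X i j y z : homog X i j y -> homog X i j z -> homog X i j (y + z).
Proof.
move=> hy hz s; rewrite ffunE => yz.
have [y0|/hy//] := eqVneq (y s) 0.
by apply: hz; apply: contraNneq yz => ->; rewrite y0.
Qed.

Lemma homogN X i j z : homog X i j z -> homog X i j (- z).
Proof. by move=> hz s; rewrite ffunE oppr_eq0 => /hz. Qed.

Lemma homogW X Y i j z : subpred X Y -> homog X i j z -> homog Y i j z.
Proof. by move=> XY hz s /hz[/XY]. Qed.

Definition restrict X z : {ffun T -> int} :=
  [ffun s => if X s then z s else 0].

Lemma bd_homog X i j y t : homog X i j y -> bd y t != 0 ->
  hd t = i + 1 /\ qd t = j.
Proof.
move=> hy; rewrite /bd => nz.
have [s ys] : exists s, y s * dm s t != 0.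
  apply/existsP; apply: contraNT nz; rewrite negb_exists => /forallP h.
  by apply/eqP; apply: big1 => s _; apply/eqP; rewrite -[_ == _]negbK h.
move: ys; rewrite mulf_eq0 negb_or => /andP[/hy[_ <- <-] nd].
by rewrite (dm_hd nd) (dm_qd nd).
Qed.

Lemma homog_restrict_bd X Y i j y : homog Y (i - 1) j y ->
  homog X i j (restrict X (finfun (bd y))).
Proof.
move=> hy s; rewrite !ffunE; case: ifP => [Xs /(bd_homog hy)[-> ->]|_].
  by split=> //; rewrite subrK.
by rewrite eqxx.
Qed.

(** Convexity lets the sum over the intermediate generators be extended from [X]
    to all generators. *)
Lemma bd_restrict_bd X i j y t : convex X -> homog X i j y -> X t ->
  bd (restrict X (finfun (bd y))) t = 0.
Proof.
move=> cX hy Xt; rewrite /bd.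
under eq_bigr => r _ do rewrite !ffunE.
transitivity (\sum_r \sum_s y s * dm s r * dm r t).
  apply: eq_bigr => r _; case: ifP => [_|/negbT nX]; first by rewrite mulr_suml.
  rewrite mul0r big1 // => s _; apply/eqP; apply: contraNT nX.
  rewrite !mulf_eq0 !negb_or -andbA => /and3P[/hy[Xs _ _] sr rt].
  exact: cX Xs Xt sr rt.
rewrite exchange_big big1 // => s _.
by under eq_bigr => r _ do rewrite -mulrA; rewrite -mulr_sumr dm_dm mulr0.
Qed.

(** From the long exact sequence of the subcomplex S of X and the quotient U:
    a cycle is first corrected to vanish on U, and then bounds in S. *)
Lemma exact_at_filtration X U S i j :
  convex X -> (forall s, X s = U s (+) S s) -> (forall s, S s -> X s) ->
  (forall s t, S s -> X t -> dm s t != 0 -> S t) ->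
  exact_at U i j -> exact_at S i j -> exact_at X i j.
Proof.
move=> cX XUS SX clS exU exS z hz cz.
have UX s : U s -> X s by move=> Us; have := SX s; rewrite XUS Us; case: (S s) => // /(_ isT).
have US s : U s -> ~~ S s by move=> Us; have := UX s Us; rewrite XUS Us.
have dSU y k s t : homog S k j y -> U t -> y s * dm s t = 0.
  move=> hy Ut; apply/eqP; apply: contraNT (US t Ut).
  rewrite mulf_eq0 negb_or => /andP[/hy[Ss _ _]]; exact: clS (UX _ Ut).
have bdSU y k t : homog S k j y -> U t -> bd y t = 0.
  by move=> hy Ut; apply: big1 => s _; apply: dSU hy Ut.
pose zU := restrict U z; pose zS := restrict S z.
have zE : z = zU + zS.
  apply/ffunP=> s; rewrite !ffunE; have := XUS s.
  case Us: (U s); case Ss: (S s) => /= Xs; rewrite ?addr0 ?add0r //.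
    by have := US s Us; rewrite Ss.
  by apply: (homog0 hz); rewrite Xs.
have hzU : homog U i j zU.
  by move=> s; rewrite ffunE; case: ifP => [Us /hz[]|_]; last by rewrite eqxx.
have hzS : homog S i j zS.
  by move=> s; rewrite ffunE; case: ifP => [Us /hz[]|_]; last by rewrite eqxx.
case: (exU zU hzU) => [t Ut|yU hyU dyU].
  by have := cz t (UX t Ut); rewrite {1}zE bdD (bdSU _ _ _ hzS Ut) addr0.
have hyX := homogW UX hyU.
pose w := restrict X (finfun (bd yU)).
have hz' : homog S i j (z - w).
  move=> s zs; have [Xs -> ->] : [/\ X s, hd s = i & qd s = j].
    apply: (homogD hz) zs; apply: homogN; exact: homog_restrict_bd hyU.
  split=> //; move: zs; rewrite !ffunE Xs.
  case Us: (U s); last by move: Xs; rewrite XUS Us.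
  by rewrite dyU // ffunE Us subrr eqxx.
case: (exS _ hz') => [t St|yS hyS dyS].
  by rewrite bdB cz ?(bd_restrict_bd cX hyX) ?subrr // SX.
exists (yU + yS) => [|t Xt]; first exact: homogD hyX (homogW SX hyS).
rewrite bdD; move: (Xt); rewrite XUS; case Ut: (U t) => /= St.
  by rewrite dyU // (bdSU _ _ _ hyS) // addr0 ffunE Ut.
by rewrite dyS // !ffunE Xt addrC subrK.
Qed.

(** The complex is the cone of a map from the span of Y0 to that of Y1 which is,
    up to signs, the bijection [f] of bases.  Subtracting a boundary makes a cycle
    vanish on Y1, and then the injectivity of this map makes it zero. *)
Lemma exact_at_cone Y Y0 Y1 (f g : T -> T) i j :
  convex Y -> (forall s, Y s = Y0 s || Y1 s) ->
  (forall s, Y0 s -> Y1 (f s)) -> (forall t, Y1 t -> Y0 (g t)) ->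
  (forall s, Y0 s -> g (f s) = s) -> (forall t, Y1 t -> f (g t) = t) ->
  (forall s, Y0 s -> dm s (f s) ^+ 2 = 1) ->
  (forall s t, Y0 s -> Y1 t -> dm s t != 0 -> t = f s) ->
  exact_at Y i j.
Proof.
move=> cY YE f1 g0 gK fK unit_f only_f z hz cz.
have Y0Y s : Y0 s -> Y s by rewrite YE => ->.
have Y1Y s : Y1 s -> Y s by rewrite YE orbC => ->.
have bdY1 y k t : homog Y0 k j y -> Y1 t -> bd y t = y (g t) * dm (g t) t.
  move=> hy Yt; rewrite /bd (bigD1 (g t)) //= big1 ?addr0 // => s sg.
  apply/eqP; apply: contraNT sg; rewrite mulf_eq0 negb_or => /andP[/hy[Ys _ _]].
  by move=> /(only_f s t Ys Yt) ->; rewrite gK.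
have cyc0 y : homog Y0 i j y -> (forall t, Y1 t -> bd y t = 0) -> forall s, y s = 0.
  move=> hy cy s; have [Ys|] := boolP (Y0 s); last exact: homog0 hy.
  have := cy _ (f1 s Ys); rewrite (bdY1 y i) ?f1 // gK //.
  move=> /eqP; rewrite mulf_eq0 => /orP[/eqP //|/eqP d0].
  by have := unit_f s Ys; rewrite d0.
pose y0 : {ffun T -> int} := [ffun s => if Y0 s then dm s (f s) * z (f s) else 0].
have hy0 : homog Y0 (i - 1) j y0.
  move=> s; rewrite ffunE; case: ifP => [Ys|_]; last by rewrite eqxx.
  rewrite mulf_eq0 negb_or => /andP[nd /hz[_ <- <-]]; split=> //.
    by rewrite (dm_hd nd) addrK.
  by rewrite (dm_qd nd).
have dy0 t : Y1 t -> bd y0 t = z t.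
  move=> Yt; rewrite (bdY1 y0 (i - 1)) // ffunE g0 // fK // mulrAC -expr2.
  by rewrite -{2}(fK t Yt) unit_f ?g0 // mul1r.
have hyY := homogW Y0Y hy0.
pose w := restrict Y (finfun (bd y0)).
have hz' : homog Y0 i j (z - w).
  move=> s zs; have [Ys -> ->] : [/\ Y s, hd s = i & qd s = j].
    apply: (homogD hz) zs; apply: homogN; exact: homog_restrict_bd hy0.
  split=> //; move: zs; rewrite !ffunE Ys.
  by move: (Ys); rewrite YE => /orP[//|Y1s]; rewrite dy0 // subrr eqxx.
exists y0 => // t Yt.
have := cyc0 _ hz' _ t; rewrite !ffunE Yt => /(_ _)/eqP.
rewrite subr_eq0 => h; apply/esym/eqP; apply: h => r Yr.
by rewrite bdB cz ?(bd_restrict_bd cY hyY) ?subrr // Y1Y.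
Qed.

End BasedComplex.

(** * Boundary components and toggled edges *)

Section Boundary.

Variable G : ribbonGraph.

Local Notation edge := 'I_(nedges G).
Implicit Types (A B : {set edge}) (e : edge) (c p : corner G) (C D : {set corner G}).

(** For the two values of b, the arcs that follow the ends of the band of e: one
    lies at the end of each side of the band.  Adding or removing the band
    composes the boundary permutation with the transposition of the two. *)
Definition side e b : corner G := inl (e, b).

Definition orb A c := porbit (boundary A) c.

Definition toggle e A := if e \in A then A :\ e else e |: A.

Lemma in_toggle e A i : (i \in toggle e A) = (i == e) (+) (i \in A).
Proof.
by rewrite /toggle; case: ifP => eA; rewrite !inE; case: eqVneq => // ->; rewrite eA.
Qed.

Lemma toggleK e : involutive (toggle e).
Proof.
by move=> A; apply/setP=> i; rewrite !in_toggle; case: eqVneq => //= _; rewrite negbK.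
Qed.

Lemma toggleC e e' A : toggle e (toggle e' A) = toggle e' (toggle e A).
Proof. by apply/setP=> i; rewrite !in_toggle addbCA. Qed.

Lemma toggleU e A : e \notin A -> toggle e A = e |: A.
Proof. by rewrite /toggle => /negbTE->. Qed.

Lemma side_neq e : side e false != side e true.
Proof. by apply/eqP=> -[]. Qed.

Lemma boundary_toggle e A :
  boundary (toggle e A) = (boundary A * tperm (side e false) (side e true))%g.
Proof.
apply/permP=> c; rewrite permM [boundary (toggle e A) c]permE [boundary A c]permE.
case: c => [h|v] /=; last by rewrite tpermD.
move: (Defs.rot G h) => [i b]; rewrite /flip in_toggle /=.
have [->|ne] := eqVneq i e; last first.
  by case: ifP => _; rewrite tpermD //; apply: contraNneq ne => -[->].
by case: b; case: ifP => /= h1; case: ifP => //= h2; rewrite ?tpermL ?tpermR //;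
   move: h1; rewrite h2.
Qed.

Lemma mem_orb A c : c \in orb A c. Proof. exact: porbit_id. Qed.

Lemma orb_sym A c c' : (c \in orb A c') = (c' \in orb A c).
Proof. exact: porbit_sym. Qed.

Lemma eq_orb A c c' : (orb A c == orb A c') = (c \in orb A c').
Proof. exact: eq_porbit_mem. Qed.

Lemma orbE A c c' : c \in orb A c' -> orb A c = orb A c'.
Proof. by rewrite -eq_orb => /eqP. Qed.

(** If so, toggling e splits this boundary component of the surface of A; if not,
    it merges the two components of the sides. *)
Definition joins A e := side e true \in orb A (side e false).

Lemma joins_toggle A e : joins (toggle e A) e = ~~ joins A e.
Proof. by rewrite /joins /orb boundary_toggle mem_porbit_mul_tperm ?side_neq. Qed.

Lemma orb_side A e b : ~~ joins A e ->
  orb (toggle e A) (side e b) = orb A (side e false) :|: orb A (side e true).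
Proof.
move=> nj; have <- := porbit_mul_tperm_merge nj; rewrite -boundary_toggle.
case: b => //; apply/eqP; rewrite eq_orb; move: (joins_toggle A e).
by rewrite nj.
Qed.

Lemma orb_id A e c : side e false \notin orb A c -> side e true \notin orb A c ->
  orb (toggle e A) c = orb A c.
Proof. by rewrite /orb boundary_toggle; exact: porbit_mul_tperm_id. Qed.

(** The condition bears on the toggled edge set, where a merge leaves only one
    component to avoid. *)
Lemma orb_id' A e b c : ~~ joins A e -> c \notin orb (toggle e A) (side e b) ->
  orb (toggle e A) c = orb A c.
Proof.
move=> nj; rewrite orb_side // inE negb_or => /andP[h1 h2].
by apply: orb_id; rewrite orb_sym.
Qed.

Lemma card_bcomps_toggle A e :
  (#|bcomps (toggle e A)| + (~~ joins A e).*2 = #|bcomps A|.+1)%N.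
Proof.
by rewrite /bcomps boundary_toggle card_porbits_mul_tperm ?side_neq.
Qed.

Lemma mem_bcomps A c : orb A c \in bcomps A. Proof. exact: mem_porbits. Qed.

Lemma bcompsE A C c : c \in C -> (C \in bcomps A) = (C == orb A c).
Proof. exact: mem_porbits_eq. Qed.

Lemma bcompsP A C : reflect (exists c, C = orb A c) (C \in bcomps A).
Proof.
by apply: (iffP imsetP) => [[c _ ->]|[c ->]]; exists c.
Qed.

Lemma bcomps_new A e : ~~ joins A e ->
  bcomps (toggle e A) :\: bcomps A = [set orb (toggle e A) (side e false)].
Proof. by move=> nj; rewrite /bcomps /orb boundary_toggle; apply: porbits_merge. Qed.

Lemma bcomps_old A e : ~~ joins A e ->
  bcomps A :\: bcomps (toggle e A) =
  [set orb A (side e false); orb A (side e true)].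
Proof. by move=> nj; rewrite /bcomps /orb boundary_toggle; apply: porbits_unmerge. Qed.

Lemma card_bcomps_toggle_le A e : (#|bcomps (toggle e A)| <= #|bcomps A|.+1)%N.
Proof. by rewrite -(card_bcomps_toggle A e) leq_addr. Qed.

Lemma card_bcomps_le A B :
  (#|bcomps B| <= #|bcomps A| + #|[set i | (i \in A) (+) (i \in B)]|)%N.
Proof.
have [n] := ubnP #|[set i | (i \in A) (+) (i \in B)]|.
elim: n B => // n IHn B leB.
have [d0|[e]] := set_0Vmem [set i | (i \in A) (+) (i \in B)].
  suff -> : B = A by exact: leq_addr.
  apply/setP=> i; have : i \notin [set i | (i \in A) (+) (i \in B)].
    by rewrite d0 inE.
  by rewrite inE; case: (i \in A); case: (i \in B).
rewrite inE => eAB.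
have eD : [set i | (i \in A) (+) (i \in toggle e B)] =
    [set i | (i \in A) (+) (i \in B)] :\ e.
  apply/setP=> i; rewrite !inE in_toggle; case: eqVneq => //= ->.
  by move: eAB; case: (e \in A); case: (e \in B).
have cD := cardsD1 e [set i | (i \in A) (+) (i \in B)].
rewrite inE eAB -eD in cD.
have := card_bcomps_toggle_le (toggle e B) e; rewrite toggleK.
by have := IHn (toggle e B); lia.
Qed.

Lemma isolP (v : {v : vertex G | v \notin codom (@src G)}) :
  val v \notin codom (@src G).
Proof. exact: (valP v). Qed.

(** The boundary components of the surface without bands are the boundary
    circles of the vertex disks, so that sending a corner to its vertex induces
    a bijection. *)
Lemma card_bcomps0 : #|bcomps (set0 : {set edge})| = #|vertex G|.
Proof.
pose vtx (c : corner G) := match c with inl h => src h | inr v => val v end.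
have vtxP c c' : (vtx c == vtx c') = (c \in orb set0 c').
  have b0 h : boundary (set0 : {set edge}) (inl h) = inl (Defs.rot G h) :> corner G.
    by rewrite permE /= /flip inE.
  have bi h n : ((boundary (set0 : {set edge}) ^+ n) (inl h))%g
      = inl ((Defs.rot G ^+ n) h)%g :> corner G.
    by elim: n => [|n IHn]; rewrite ?perm1 // !expgSr !permM IHn b0.
  have br v n : ((boundary (set0 : {set edge}) ^+ n) (inr v))%g = inr v :> corner G.
    by elim: n => [|n IHn]; rewrite ?perm1 // !expgSr !permM IHn permE.
  have ninr h (v : {v : vertex G | v \notin codom (@src G)}) :
      (src h == val v) = false.
    by apply/eqP=> hv; move: (isolP v); rewrite -hv codom_f.
  case: c c' => [h|v] [k|w] /=.
  - rewrite rotP porbit_sym; apply/porbitP/porbitP=> -[n e]; exists n.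
      by rewrite bi e.
    by move: e; rewrite bi => -[].
  - by rewrite ninr; apply/esym/porbitP=> -[n]; rewrite br.
  - by rewrite eq_sym ninr; apply/esym/porbitP=> -[n]; rewrite bi.
  - apply/eqP/porbitP=> [/val_inj->|[n]]; first by exists 0%N; rewrite perm1.
    by rewrite br => -[->].
have vtx_surj v : exists c, vtx c = v.
  have [/codomP[h ->]|nv] := boolP (v \in codom (@src G)); first by exists (inl h).
  by exists (inr (Sub v nv)).
pose f (C : {set corner G}) := [pick v | [exists c in C, vtx c == v]].
have fE c : f (orb set0 c) = Some (vtx c).
  rewrite /f; case: pickP => [v /exists_inP[c' cc' /eqP<-]|/(_ (vtx c))].
    by congr Some; apply/eqP; rewrite vtxP.
  by case/exists_inP; exists c => //; exact: mem_orb.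
rewrite -(card_in_imset (f := f)); last first.
  move=> _ _ /bcompsP[c ->] /bcompsP[c' ->]; rewrite !fE => -[] /eqP.
  by rewrite vtxP -eq_orb => /eqP.
rewrite -[RHS](card_imset _ (@Some_inj _)); apply: eq_card => o.
apply/imsetP/imsetP=> [[_ /bcompsP[c ->] ->]|[v _ ->]].
  by rewrite fE; exists (vtx c).
have [c <-] := vtx_surj v; exists (orb set0 c); last by rewrite fE.
exact: mem_bcomps.
Qed.

(** Take an edge set with the fewest boundary components.  No toggle merges two of
    them, so the component of a corner is closed under moving to the next
    half-edge around a vertex and to the other half of an edge; by connectedness
    it contains all corners. *)
Lemma exists_quasi_tree : connected G -> exists A, bcomps A = [set setT].
Proof.
move=> conG; pose A := [arg min_(A < set0) #|@bcomps G A|].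
have minA B : (#|bcomps A| <= #|bcomps B|)%N.
  by rewrite /A; case: arg_minnP => // A' _; apply.
have jA e : joins A e.
  apply/negPn/negP=> nj; have := card_bcomps_toggle A e; rewrite nj.
  by have := minA (toggle e A); lia.
exists A.
suff tot c c' : c \in orb A c'.
  have [v0 _] : exists v : vertex G, v \in predT.
    by apply/card_gt0P; exact: vertex_gt0.
  have [c0 _] : exists c : corner G, true.
    have [/codomP[h _]|nv] := boolP (v0 \in codom (@src G)); first by exists (inl h).
    by exists (inr (Sub v0 nv)).
  have oT c : orb A c = setT by apply/setP=> c'; rewrite tot inE.
  by apply/setP=> C; rewrite inE; apply/bcompsP/eqP=> [[c ->]|->]; [|exists c0].
have opp i b : (inl (i, b) : corner G) \in orb A (inl (i, ~~ b)).
  by case: b => /=; [|rewrite orb_sym]; exact: jA.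
have flipA h c0 : (inl (flip A h) \in orb A c0) = (inl h \in orb A c0).
  rewrite /flip; case: ifP => // _; case: h => i b /=.
  by rewrite -!eq_orb (orbE (opp i b)).
have rotA h c0 : (inl (Defs.rot G h) \in orb A c0) = (inl h \in orb A c0).
  have := stable_porbit (boundary A) c0 (inl h).
  by rewrite permE /= -/(orb A c0) flipA.
have rotnA n h c0 : (inl ((Defs.rot G ^+ n) h)%g \in orb A c0) = (inl h \in orb A c0).
  by elim: n => [|n IHn]; rewrite ?perm1 // expgSr permM rotA.
have srcA h k c0 : src h = src k -> inl h \in orb A c0 -> inl k \in orb A c0.
  by move=> /eqP; rewrite rotP => /porbitP[n ->]; rewrite rotnA.
have walk h v : connect (@adjacent G) (src h) v ->
    forall k, src k = v -> inl k \in orb A (inl h).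
  case/connectP=> q; elim: q h => [|w q IHq] h /= => [_ ->|].
    by move=> k /esym e; apply: srcA e (mem_orb _ _).
  case/andP=> /existsP[[i b] /andP[/eqP ih /eqP iw]] pq lq k kv.
  have := IHq (i, ~~ b); rewrite iw => /(_ pq lq k kv).
  rewrite -!eq_orb => /eqP->; rewrite -(orbE (opp i b)) eq_orb.
  by apply: (srcA h) => //; exact: mem_orb.
have isol v w : v \notin codom (@src G) -> connect (@adjacent G) v w -> w = v.
  move=> nv /connectP[[|x q] //= /andP[/existsP[h /andP[/eqP hv _]] _] _].
  by move: nv; rewrite -hv codom_f.
case: c c' => [h|v] [k|w].
- exact: (walk k (src h)).
- have := isol _ _ (isolP w) (conG _ (src h)) => e.
  by move: (isolP w); rewrite -e codom_f.
- have := isol _ _ (isolP v) (conG _ (src k)) => e.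
  by move: (isolP v); rewrite -e codom_f.
- by have /val_inj -> := isol _ _ (isolP v) (conG _ (val w)); exact: mem_orb.
Qed.

End Boundary.

(** * The maps of the cube of resolutions *)

Lemma enum_set2 (T : finType) (x y : T) : x != y ->
  enum [set x; y] = [:: x; y] \/ enum [set x; y] = [:: y; x].
Proof.
move=> xy; have := cardE [set x; y]; rewrite cards2 xy.
have := enum_uniq [set x; y].
have := mem_enum [set x; y]; case: (enum _) => [|u [|v [|w q]]] //= m.
rewrite inE andbT => uv _.
have := m u; have := m v; rewrite !inE !eqxx orbT /=.
case/esym/orP=> /eqP ev /esym/orP[]/eqP eu; move: uv; rewrite ev eu ?eqxx //.
  by right.
by left.
Qed.

Lemma m_coefC x y z : m_coef x y z = m_coef y x z.
Proof. by case: x; case: y. Qed.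

Lemma Delta_coefC x y z : Delta_coef x y z = Delta_coef x z y.
Proof. by case: x; case: y; case: z. Qed.

Section Cube.

Variable G : ribbonGraph.

Local Notation edge := 'I_(nedges G).
Implicit Types (A B : {set edge}) (e : edge) (c p : corner G).
Implicit Types (C D : {set corner G}) (s t u : state G) (S : seq (corner G)).

Definition lab s c := label s (orb (edges_of s) c).

Lemma plus_sub s C : C \in plus_of s -> C \in comps_of s.
Proof. by move=> Cs; have /subsetP := valP s; apply. Qed.

Lemma lab_orb s c c' : c \in orb (edges_of s) c' -> lab s c = lab s c'.
Proof. by rewrite /lab => /orbE ->. Qed.

Lemma state_eq s t :
  edges_of s = edges_of t -> (forall c, lab s c = lab t c) -> s = t.
Proof.
move=> est lst; apply: val_inj; rewrite [val s]surjective_pairing.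
rewrite [val t]surjective_pairing -/(edges_of s) -/(edges_of t) est; congr pair.
apply/setP=> C; apply/idP/idP => Cs.
  have := plus_sub Cs => /bcompsP[c eC].
  by have := lst c; rewrite /lab /label /plus_of -eC -est -eC Cs.
have := plus_sub Cs => /bcompsP[c eC].
by have := lst c; rewrite /lab /label /plus_of -eC est -eC Cs => ->.
Qed.

Lemma mk_state_proof A (f : corner G -> bool) :
  [set C in bcomps A | [exists c in C, f c]] \subset bcomps A.
Proof. by apply/subsetP=> C; rewrite inE => /andP[]. Qed.

(** Meaningful when [f] is constant on the boundary components. *)
Definition mk_state A (f : corner G -> bool) : state G :=
  Sub (A, [set C in bcomps A | [exists c in C, f c]]) (mk_state_proof A f).

Lemma edges_mk_state A f : edges_of (mk_state A f) = A.
Proof. by rewrite /edges_of SubK. Qed.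

Lemma lab_mk_state A f c : (forall c c', c \in orb A c' -> f c = f c') ->
  lab (mk_state A f) c = f c.
Proof.
move=> ff; rewrite /lab /label /plus_of SubK /= edges_mk_state inE mem_bcomps /=.
apply/exists_inP/idP=> [[c' /ff ->] //|fc]; exists c => //; exact: mem_orb.
Qed.

(** The components affected by a merge are exactly those in the new one. *)
Lemma orb_common A e c : ~~ joins A e ->
  (orb A c \in bcomps (toggle e A)) = (c \notin orb (toggle e A) (side e false)).
Proof.
move=> nj; apply/idP/idP=> [cB|nc]; last first.
  by rewrite -(orb_id' nj nc) mem_bcomps.
apply/negP=> /orbE ec.
have := bcomps_new nj => /setP/(_ (orb A c)); rewrite !inE mem_bcomps /=.
by move: cB; rewrite (bcompsE _ (mem_orb A c)) ec => ->.
Qed.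

Lemma common_labels s t e :
  edges_of t = toggle e (edges_of s) -> ~~ joins (edges_of s) e ->
  [forall C in comps_of s :&: comps_of t, label s C == label t C] =
  [forall c, (c \notin orb (edges_of t) (side e false)) ==> (lab s c == lab t c)].
Proof.
move=> est nj; apply/forall_inP/forallP=> [h c|h C].
  apply/implyP; rewrite est => nc.
  have ct : orb (edges_of s) c \in comps_of t by rewrite /comps_of est orb_common.
  have := h (orb (edges_of s) c); rewrite inE mem_bcomps ct => /(_ isT).
  by rewrite /lab est (orb_id' nj nc).
rewrite inE => /andP[/bcompsP[c ->] ct].
have nc : c \notin orb (toggle e (edges_of s)) (side e false).
  by rewrite -orb_common // -est.
by have := h c; rewrite est nc /lab est (orb_id' nj nc).
Qed.

Lemma edge_coef_merge s t e :
  edges_of t = toggle e (edges_of s) -> ~~ joins (edges_of s) e ->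
  edge_coef s t =
  if [forall c, (c \notin orb (edges_of t) (side e false)) ==> (lab s c == lab t c)]
  then m_coef (lab s (side e false)) (lab s (side e true)) (lab t (side e false))
  else 0.
Proof.
move=> est nj; rewrite /edge_coef (common_labels est nj); case: ifP => // _.
rewrite /comps_of est bcomps_new // bcomps_old // enum_set1 /lab est.
have ne : orb (edges_of s) (side e false) != orb (edges_of s) (side e true).
  by rewrite eq_orb orb_sym.
by case: (enum_set2 ne) => -> //; rewrite m_coefC.
Qed.

Lemma edge_coef_split s t e :
  edges_of t = toggle e (edges_of s) -> joins (edges_of s) e ->
  edge_coef s t =
  if [forall c, (c \notin orb (edges_of s) (side e false)) ==> (lab t c == lab s c)]
  then Delta_coef (lab s (side e false)) (lab t (side e false)) (lab t (side e true))
  else 0.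
Proof.
move=> est js; have ets : edges_of s = toggle e (edges_of t) by rewrite est toggleK.
have nj : ~~ joins (edges_of t) e by rewrite est joins_toggle js.
rewrite /edge_coef.
have -> : [forall C in comps_of s :&: comps_of t, label s C == label t C] =
    [forall C in comps_of t :&: comps_of s, label t C == label s C].
  by apply: eq_forallb => C; rewrite setIC eq_sym.
rewrite (common_labels ets nj); case: ifP => // _.
rewrite /comps_of ets bcomps_new // bcomps_old // enum_set1 /lab ets.
have ne : orb (edges_of t) (side e false) != orb (edges_of t) (side e true).
  by rewrite eq_orb orb_sym.
by case: (enum_set2 ne) => -> //; rewrite Delta_coefC.
Qed.

End Cube.

(** * The cube maps as multiplications by monomials *)

Section Square.

Variable G : ribbonGraph.

Local Notation edge := 'I_(nedges G).
Implicit Types (A B : {set edge}) (e : edge) (c p x : corner G).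
Implicit Types (C D U : {set corner G}) (s t u : state G) (S w : seq (corner G)).

(** A list S of corners stands for a product of corner variables. *)
Definition cnt A S c := count [in orb A c] S.

Arguments cnt : simpl never.

(** Whether the monomial S represents the basis element s in the quotient ring
    V(edges_of s): the degree of S on a component is 0 or 1 according to the label
    of s.  A monomial of degree 2 or more on some component represents zero. *)
Definition mono s S := [forall c, cnt (edges_of s) S c == ~~ lab s c :> nat].

Lemma cnt_orb A S c c' : c \in orb A c' -> cnt A S c = cnt A S c'.
Proof. by rewrite /cnt => /orbE ->. Qed.

Lemma mono_cover t S U xs :
  (forall c, c \in U -> exists2 x, x \in xs & c \in orb (edges_of t) x) ->
  mono t S =
  [forall c, (c \notin U) ==> (cnt (edges_of t) S c == ~~ lab t c :> nat)] &&
  all (fun c => cnt (edges_of t) S c == ~~ lab t c :> nat) xs.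
Proof.
move=> cov; apply/forallP/andP=> [h|[/forallP h1 /allP h2] c].
  by split; [apply/forallP=> c; rewrite h implybT | apply/allP=> c _; exact: h].
have [cU|] := boolP (c \in U); last by apply/implyP; exact: h1.
by have [x xs_x cx] := cov c cU; rewrite (cnt_orb _ cx) (lab_orb cx); exact: h2.
Qed.

Lemma monomial_inj s s' S :
  edges_of s = edges_of s' -> mono s S -> mono s' S -> s = s'.
Proof.
move=> es /forallP ms /forallP ms'; apply: state_eq => // c.
by have := ms c; have := ms' c; rewrite es => /eqP->; case: (lab s c); case: (lab s' c).
Qed.

Lemma exists_mono A S : (forall c, (cnt A S c <= 1)%N) ->
  exists2 s, edges_of s = A & mono s S.
Proof.
move=> le1; exists (mk_state A (fun c => cnt A S c == 0)%N).
  exact: edges_mk_state.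
apply/forallP=> c; rewrite edges_mk_state lab_mk_state.
  by have := le1 c; case: (cnt A S c) => [|[]].
by move=> c1 c2 /cnt_orb ->.
Qed.

Lemma sum_mono A S (F : state G -> int) s :
  edges_of s = A -> mono s S ->
  \sum_(s' | edges_of s' == A) (mono s' S)%:R * F s' = F s.
Proof.
move=> es ms; rewrite (bigD1 s) ?es //= ms mul1r big1 ?addr0 // => s' /andP[/eqP es' ne].
case ms': (mono s' S); last by rewrite mul0r.
by case/eqP: ne; apply: monomial_inj ms' ms; rewrite es es'.
Qed.

Lemma sum_mono0 A S (F : state G -> int) c :
  (1 < cnt A S c)%N -> \sum_(s' | edges_of s' == A) (mono s' S)%:R * F s' = 0.
Proof.
move=> c2; rewrite big1 // => s' /eqP es'.
case ms': (mono s' S); last by rewrite mul0r.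
by have /forallP/(_ c)/eqP := ms'; rewrite es' => e; move: c2; rewrite e; case: (lab s' c).
Qed.

Lemma cnt_toggle_side A e S b : ~~ joins A e ->
  cnt (toggle e A) S (side e b) =
  (cnt A S (side e false) + cnt A S (side e true))%N.
Proof.
move=> nj; rewrite /cnt -count_predUI [X in (_ + X)%N](_ : _ = 0%N) ?addn0.
  by apply: eq_count => c; rewrite /= orb_side // inE.
apply/eqP; rewrite -leqn0 leqNgt -has_count; apply/hasPn=> c _ /=.
apply: contra nj => /andP[c1 c2]; rewrite /joins -eq_orb.
by rewrite -(orbE c1) -(orbE c2).
Qed.

Lemma cnt_toggle_id A e S b c : ~~ joins A e ->
  c \notin orb (toggle e A) (side e b) -> cnt (toggle e A) S c = cnt A S c.
Proof. by move=> nj nc; rewrite /cnt (orb_id' nj nc). Qed.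

(** A merge is the projection between the quotient rings. *)
Lemma sum_mono_merge A e t S : edges_of t = toggle e A -> ~~ joins A e ->
  \sum_(s | edges_of s == A) (mono s S)%:R * edge_coef s t = (mono t S)%:R.
Proof.
move=> et nj.
have cov c : c \in orb (edges_of t) (side e false) ->
    exists2 x, x \in [:: side e false] & c \in orb (edges_of t) x.
  by exists (side e false); rewrite ?mem_head.
have Ut := mono_cover S cov.
case: (boolP [forall c, (cnt A S c <= 1)%N]) => [/forallP le1|]; last first.
  rewrite negb_forall => /existsP[c]; rewrite -ltnNge => c2.
  rewrite (sum_mono0 _ c2); case mt: (mono t S) => //.
  suff : (cnt A S c <= cnt (edges_of t) S c)%N.
    by have /forallP/(_ c)/eqP -> := mt; case: (lab t c); lia.
  rewrite et; have [cU|nc] := boolP (c \in orb (toggle e A) (side e false)).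
    rewrite (cnt_orb _ cU) cnt_toggle_side //.
    move: cU; rewrite orb_side // inE => /orP[] /cnt_orb ->; lia.
  by rewrite (cnt_toggle_id _ nj nc).
have [s es ms] := exists_mono le1; rewrite (sum_mono _ es ms).
have := ms => /forallP {}ms.
have ets : edges_of t = toggle e (edges_of s) by rewrite es.
rewrite (edge_coef_merge ets) ?es // Ut /= andbT et cnt_toggle_side // -es.
rewrite !(eqP (ms _)).
have -> : [forall c, (c \notin orb (toggle e (edges_of s)) (side e false)) ==>
       (cnt (toggle e (edges_of s)) S c == ~~ lab t c :> nat)] =
    [forall c, (c \notin orb (toggle e (edges_of s)) (side e false)) ==>
       (lab s c == lab t c)].
  apply: eq_forallb => c; case: (boolP (c \in _)) => //= nc.
  rewrite (cnt_toggle_id _ _ nc) ?es // -es (eqP (ms c)).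
  by case: (lab s c); case: (lab t c).
case: ifP => //= _.
by case: (lab s _); case: (lab s _); case: (lab t _).
Qed.

(** A split is multiplication by the sum of the variables of the two sides: with a
    and b in distinct components after the split, this is x -> x (a + b). *)
Lemma sum_mono_split A e t S : edges_of t = toggle e A -> joins A e ->
  \sum_(s | edges_of s == A) (mono s S)%:R * edge_coef s t =
  (mono t (side e false :: S))%:R + (mono t (side e true :: S))%:R.
Proof.
move=> et jA; set a := side e false; set b := side e true.
have eA : A = toggle e (edges_of t) by rewrite et toggleK.
have nj : ~~ joins (edges_of t) e by rewrite et joins_toggle jA.
have oA : orb A a = orb (edges_of t) a :|: orb (edges_of t) b.
  by rewrite eA orb_side.
have cov c : c \in orb A a -> exists2 x, x \in [:: a; b] & c \in orb (edges_of t) x.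
  rewrite oA inE => /orP[ca|cb]; first by exists a; rewrite ?mem_head.
  by exists b; rewrite // !inE eqxx orbT.
have Ut := mono_cover _ cov.
have ab : a \notin orb (edges_of t) b by rewrite orb_sym.
have cntab : cnt A S a = (cnt (edges_of t) S a + cnt (edges_of t) S b)%N.
  by rewrite eA cnt_toggle_side.
have cnt_in c x : x \in orb (edges_of t) c ->
    cnt (edges_of t) (x :: S) c = (cnt (edges_of t) S c).+1.
  by rewrite /cnt /= => ->.
have cnt_out c x : x \notin orb (edges_of t) c ->
    cnt (edges_of t) (x :: S) c = cnt (edges_of t) S c.
  by rewrite /cnt /= => /negbTE ->.
have cntab' c x : x \in [:: a; b] -> c \notin orb A a ->
    cnt (edges_of t) (x :: S) c = cnt A S c.
  move=> xab nc; rewrite cnt_out; first by rewrite eA (@cnt_toggle_id _ e _ false) // -eA.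
  apply: contra nc => xc; rewrite oA; move: xab xc; rewrite !inE orb_sym.
  by case/orP=> /eqP-> ->; rewrite ?orbT.
rewrite !Ut /= !andbT.
rewrite cnt_in ?mem_orb // [cnt _ (a :: S) b]cnt_out //.
rewrite [cnt _ (b :: S) a]cnt_out; last by rewrite orb_sym.
rewrite cnt_in ?mem_orb //.
case: (boolP [forall c, (cnt A S c <= 1)%N]) => [/forallP le1|]; last first.
  rewrite negb_forall => /existsP[c]; rewrite -ltnNge => c2; rewrite (sum_mono0 _ c2).
  have [cU|nc] := boolP (c \in orb A a).
    rewrite (cnt_orb _ cU) cntab in c2.
    have no1 m n (l l' : bool) : (1 < m + n)%N ->
        ((m.+1 == ~~ l :> nat) && (n == ~~ l' :> nat) = false).
      move=> mn; apply/negP=> /andP[/eqP h1 /eqP h2].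
      by move: h1 h2 mn; case: l; case: l'; lia.
    by rewrite no1 // andbF [X in _ && X]andbC no1 ?andbF // addnC.
  have no x : x \in [:: a; b] -> [forall c, (c \notin orb A a) ==>
      (cnt (edges_of t) (x :: S) c == ~~ lab t c :> nat)] = false.
    move=> xab; apply/negP=> /forallP/(_ c); rewrite nc /= (cntab' _ _ xab nc) => /eqP h.
    by move: c2; rewrite h; case: (lab t c).
  by rewrite !no // !inE eqxx ?orbT.
have [s es ms] := exists_mono le1; rewrite (sum_mono _ es ms).
have := ms => /forallP {}ms.
have ets : edges_of t = toggle e (edges_of s) by rewrite es.
rewrite (edge_coef_split ets) ?es //.
have fE x : x \in [:: a; b] -> [forall c, (c \notin orb A a) ==>
      (cnt (edges_of t) (x :: S) c == ~~ lab t c :> nat)] =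
      [forall c, (c \notin orb A a) ==> (lab t c == lab s c)].
  move=> xab; apply: eq_forallb => c; case: (boolP (c \in _)) => //= nc.
  rewrite (cntab' _ _ xab nc) -es (eqP (ms c)).
  by case: (lab s c); case: (lab t c).
rewrite !fE ?inE ?eqxx ?orbT //; case: ifP => //= _.
have := ms a; rewrite es cntab -/a -/b => /eqP.
by case: (lab s a); case: (lab t a); case: (lab t b);
  case: (cnt _ S a) => [|[|n1]]; case: (cnt _ S b) => [|[|n2]] //=.
Qed.

End Square.

(** * The differential squares to zero *)

Section Differential.

Variable G : ribbonGraph.

Local Notation edge := 'I_(nedges G).
Implicit Types (A B : {set edge}) (e : edge) (c p x : corner G).
Implicit Types (C D U : {set corner G}) (s t u : state G) (S w : seq (corner G)).

(** The list of the monomials whose sum is the factor by which the map of the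
    edge e multiplies: 1 for a merge, the two sides of the band for a split. *)
Definition factors A e : seq (seq (corner G)) :=
  if joins A e then [:: [:: side e false]; [:: side e true]] else [:: [::]].

Lemma sum_mono_factors A e t S : edges_of t = toggle e A ->
  \sum_(s | edges_of s == A) (mono s S)%:R * edge_coef s t =
  \sum_(w <- factors A e) (mono t (w ++ S))%:R.
Proof.
move=> et; rewrite /factors; case: ifP => [jA|/negbT nj].
  by rewrite !big_cons big_nil addr0 (sum_mono_split _ et).
by rewrite big_seq1 (sum_mono_merge _ et).
Qed.

(** Every basis element is represented by a monomial: the product of one variable
    for each component labelled v_-. *)
Lemma state_mono s : exists S, forall s', edges_of s' = edges_of s ->
  mono s' S = (s' == s).
Proof.
pose A := edges_of s; pose rep c := odflt c [pick x in orb A c].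
have rep_mem c : rep c \in orb A c.
  by rewrite /rep; case: pickP => [x //|/(_ c)]; rewrite mem_orb.
have rep_orb c c' : c \in orb A c' -> rep c = rep c'.
  move=> /orbE cc'; rewrite /rep cc'.
  by case: pickP => [x //|/(_ c')]; rewrite mem_orb.
pose S := enum [pred x | ~~ lab s x && (x == rep x)]; exists S => s' es.
have ms : mono s S.
  apply/forallP=> c; apply/eqP; rewrite /cnt -/A.
  transitivity #|[pred x | (x \in orb A c) && (~~ lab s x && (x == rep x))]|.
    by rewrite cardE -size_filter /enum_mem -filter_predI; congr size; exact: eq_filter.
  case ls: (lab s c) => /=.
    apply: eq_card0 => x; rewrite inE; apply/andP=> -[xc /andP[]].
    by rewrite (lab_orb xc) ls.
  rewrite -(card1 (rep c)); apply: eq_card => x; rewrite !inE.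
  apply/andP/eqP=> [[xc /andP[_ /eqP->]]|->]; first exact: rep_orb.
  rewrite rep_mem (lab_orb (rep_mem c)) ls; split=> //.
  by apply/eqP/esym; exact: rep_orb.
apply/idP/eqP => [ms'|-> //]; exact: monomial_inj es ms' ms.
Qed.

Lemma mono_perm u S S' : perm_eq S S' -> mono u S = mono u S'.
Proof.
by move=> /seq.permP SS'; apply: eq_forallb => c; rewrite /cnt SS'.
Qed.

Lemma mono_cons_orb u S x y : x \in orb (edges_of u) y ->
  mono u (x :: S) = mono u (y :: S).
Proof.
move=> xy; apply: eq_forallb => c; rewrite /cnt /=.
by rewrite -!eq_orb (orbE xy).
Qed.

(** Two bands interlaced on one component.  The second toggle reconnects the two
    sides of the first band, so they lie on the component that it creates. *)
Lemma toggle2_joins A e e' : joins A e -> joins A e' ->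
  ~~ joins (toggle e A) e' -> ~~ joins (toggle e' A) e ->
  side e false \in orb (toggle e' (toggle e A)) (side e' false).
Proof.
move=> je je' nj' nj; set B := toggle e' _.
have nje : ~~ joins (toggle e A) e by rewrite joins_toggle je.
apply: contraT => nin; have eo := orb_id' nj' nin.
have : joins B e by rewrite /B toggleC joins_toggle.
by rewrite /joins eo -/(joins _ _) (negbTE nje).
Qed.

(** Two bands between the same two components.  Undoing the second toggle would
    reconnect the two sides of the first band, so they lie on the two components
    that meet the second band. *)
Lemma toggle2_not_joins A e e' b : ~~ joins A e -> ~~ joins A e' ->
  joins (toggle e A) e' -> joins (toggle e' A) e ->
  side e b \in orb (toggle e' (toggle e A)) (side e' false)
            :|: orb (toggle e' (toggle e A)) (side e' true).
Proof.
move=> nje nje' j' j; set B := toggle e' _.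
have njB : ~~ joins B e' by rewrite /B joins_toggle j'.
rewrite -(orb_side false njB) /B toggleK.
have je : joins (toggle e A) e by rewrite joins_toggle.
have njBe : ~~ joins B e by rewrite /B toggleC joins_toggle j.
have wl : side e false \in orb (toggle e' B) (side e' false).
  apply: contraT => nin; have eo := orb_id' njB nin.
  by move: je; rewrite -[toggle e A](toggleK e') -/B /joins eo -/(joins _ _) (negbTE njBe).
rewrite /B toggleK in wl.
case: b => //; rewrite -eq_orb -(orbE wl) eq_orb; exact: je.
Qed.

(** Both paths end with the same number of components, hence contain equally many
    splits.  If the same edges split along both, the factors are the same.  Otherwise
    there is one split along each path, for e on one and for e' on the other, and
    the two preceding lemmas identify the variables. *)
Lemma face_factors A e e' u S : edges_of u = toggle e' (toggle e A) ->
  \sum_(w <- factors A e) \sum_(w' <- factors (toggle e A) e')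
     (mono u (w' ++ w ++ S))%:R =
  \sum_(w <- factors A e') \sum_(w' <- factors (toggle e' A) e)
     (mono u (w' ++ w ++ S))%:R :> int.
Proof.
move=> eu.
have c1 := card_bcomps_toggle A e; have c2 := card_bcomps_toggle A e'.
have c3 := card_bcomps_toggle (toggle e A) e'.
have c4 := card_bcomps_toggle (toggle e' A) e; rewrite toggleC in c4.
have sw x y S' : mono u [:: x, y & S'] = mono u [:: y, x & S'].
  by apply: mono_perm; apply/seq.permP=> P /=; rewrite addnCA.
rewrite /factors; move: c1 c2 c3 c4.
case je: (joins A e); case je': (joins A e');
  case j': (joins (toggle e A) e'); case j: (joins (toggle e' A) e) => /=;
  rewrite ?big_cons ?big_nil ?addr0 /= => c1 c2 c3 c4 //; try by exfalso; lia.
- by rewrite !(sw (side e' _) (side e _)) addrACA.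
- (* both bands in turn cut one component in two and then reconnect it *)
  have ab : side e false \in orb (edges_of u) (side e' false).
    by rewrite eu; apply: toggle2_joins; rewrite ?je ?je' ?j' ?j.
  have a2 : side e true \in orb (edges_of u) (side e false).
    by rewrite eu toggleC -/(joins _ _) joins_toggle j.
  have b2 : side e' true \in orb (edges_of u) (side e' false).
    by rewrite eu -/(joins _ _) joins_toggle j'.
  by rewrite (mono_cons_orb _ a2) (mono_cons_orb _ b2) (mono_cons_orb _ ab).
- (* both bands in turn connect two components and then cut them apart *)
  have inU b := @toggle2_not_joins A e e' b; rewrite -eu je je' j j' in inU.
  have nab : side e true \notin orb (edges_of u) (side e false).
    by rewrite eu toggleC -/(joins _ _) joins_toggle j.
  have := inU false isT isT isT isT; have := inU true isT isT isT isT.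
  rewrite !inE => /orP[] h1 /orP[] h2.
  + by move: nab; rewrite -eq_orb (orbE h1) (orbE h2) eqxx.
  + by rewrite (mono_cons_orb _ h1) (mono_cons_orb _ h2) addrC.
  + by rewrite (mono_cons_orb _ h1) (mono_cons_orb _ h2).
  + by move: nab; rewrite -eq_orb (orbE h1) (orbE h2) eqxx.
Qed.

Lemma face_expand s u e e' S : edges_of u = toggle e' (toggle e (edges_of s)) ->
  (forall s', edges_of s' = edges_of s -> mono s' S = (s' == s)) ->
  \sum_(t | edges_of t == toggle e (edges_of s)) edge_coef s t * edge_coef t u =
  \sum_(w <- factors (edges_of s) e)
    \sum_(w' <- factors (toggle e (edges_of s)) e') (mono u (w' ++ w ++ S))%:R.
Proof.
move=> eu mS.
transitivity (\sum_(t | edges_of t == toggle e (edges_of s))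
    \sum_(w <- factors (edges_of s) e) (mono t (w ++ S))%:R * edge_coef t u).
  apply: eq_bigr => t /eqP et; rewrite -mulr_suml -(sum_mono_factors _ et).
  by congr (_ * _); rewrite (sum_mono _ (erefl _)) // mS.
rewrite exchange_big; apply: eq_bigr => w _.
exact: sum_mono_factors.
Qed.

Lemma faceC s u e e' : edges_of u = toggle e' (toggle e (edges_of s)) ->
  \sum_(t | edges_of t == toggle e (edges_of s)) edge_coef s t * edge_coef t u =
  \sum_(t | edges_of t == toggle e' (edges_of s)) edge_coef s t * edge_coef t u.
Proof.
move=> eu; have [S mS] := state_mono s.
rewrite (face_expand eu mS) (face_factors _ eu) -(face_expand _ mS) //.
by rewrite toggleC.
Qed.

Definition sgn A e : int := (-1) ^+ #|[set i in A | (i < e)%N]|.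

Lemma sgnU A e e' : e \notin A ->
  sgn (e |: A) e' = (if (e < e')%N then -1 else 1) * sgn A e'.
Proof.
move=> eA; rewrite /sgn; case: ifP => ee'.
  have -> : [set i in e |: A | (i < e')%N] = e |: [set i in A | (i < e')%N].
    by apply/setP=> i; rewrite !inE; case: eqVneq => // ->; rewrite ee'.
  by rewrite cardsU1 inE (negbTE eA) add1n exprS.
rewrite mul1r; congr (_ ^+ _); apply: eq_card => i; rewrite !inE.
by case: eqVneq => [->|ne] /=; rewrite ?ee' ?andbF.
Qed.

Lemma d_coefE s t : d_coef s t = \sum_(e | (e \notin edges_of s) &&
   (edges_of t == toggle e (edges_of s))) sgn (edges_of s) e * edge_coef s t.
Proof.
apply: eq_bigl => e; case: (boolP (e \in _)) => //= ne.
by rewrite toggleU.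
Qed.

(** The two paths around a face have the same coefficients and opposite signs, so
    the sum over ordered pairs of edges is its own opposite. *)
Lemma d_coef_d_coef s u : \sum_t d_coef s t * d_coef t u = 0.
Proof.
pose A := edges_of s.
pose h e e' : int := if [&& e \notin A, e' \notin e |: A & edges_of u == e' |: (e |: A)]
  then sgn A e * sgn (e |: A) e' *
    \sum_(t | edges_of t == e |: A) edge_coef s t * edge_coef t u else 0.
transitivity (\sum_e \sum_e' h e e').
  transitivity (\sum_t \sum_e \sum_e'
    if [&& e \notin A, edges_of t == e |: A, e' \notin edges_of t
         & edges_of u == e' |: edges_of t]
    then sgn A e * edge_coef s t * (sgn (edges_of t) e' * edge_coef t u) else 0).
    apply: eq_bigr => t _; rewrite /d_coef big_mkcond mulr_suml.
    apply: eq_bigr => e _; rewrite big_mkcond mulr_sumr.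
    apply: eq_bigr => e' _; rewrite -/A.
    case: (boolP (e \in A)) => _ /=; first by rewrite mul0r.
    case: (_ == _) => /=; last by rewrite mul0r.
    by case: ifP => _; rewrite ?mulr0.
  rewrite exchange_big; apply: eq_bigr => e _.
  rewrite exchange_big; apply: eq_bigr => e' _; rewrite /h.
  case: (boolP (e \in A)) => eA /=; first by rewrite big1.
  rewrite -big_mkcond (eq_bigl (fun t => [&& edges_of t == e |: A,
      e' \notin e |: A & edges_of u == e' |: (e |: A)])).
    case: (boolP (_ && _)) => cond; last by rewrite big1 // => t; rewrite andbF.
    rewrite big_distrr; apply: eq_big => [t|t /andP[/eqP-> _]]; first by rewrite andbT.
    by rewrite /= mulrACA.
  by move=> t /=; case: eqP => //= ->.
have hC e e' : h e' e = - h e e'.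
  rewrite /h; have [<-|ne] := eqVneq e e'; first by rewrite setU11 andbF oppr0.
  have -> : [&& e \notin A, e' \notin e |: A & edges_of u == e' |: (e |: A)] =
      [&& e' \notin A, e \notin e' |: A & edges_of u == e |: (e' |: A)].
    by rewrite !inE !negb_or ne eq_sym ne /= setUCA andbCA.
  case: ifP => [/and3P[e'A]|_]; last by rewrite oppr0.
  rewrite !inE negb_or => /andP[_ eA] /eqP eu.
  have eu' : edges_of u = toggle e' (toggle e A).
    by rewrite (toggleU eA) toggleU ?eu 1?setUCA // !inE negb_or eq_sym ne.
  rewrite -(toggleU eA) -(toggleU e'A) (faceC eu') -mulNr; congr (_ * _).
  rewrite (toggleU eA) (toggleU e'A) !sgnU //.
  case: (ltngtP e e') => [_|_|/val_inj ee'] //; last by rewrite ee' eqxx in ne.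
    by ring.
  by ring.
apply/eqP; rewrite -[_ == 0]orbF -[false]/((2 : int) == 0) orbC -mulf_eq0 mulr_natl mulr2n.
rewrite {2}exchange_big -big_split big1 // => e _ /=.
by rewrite -big_split big1 // => e' _ /=; rewrite (hC e e') addrN.
Qed.

End Differential.

(** * Degrees and the marked component *)

Section Degrees.

Variable G : ribbonGraph.

Local Notation edge := 'I_(nedges G).
Implicit Types (A B : {set edge}) (e : edge) (c p x : corner G).
Implicit Types (C D U : {set corner G}) (s t u : state G).

Lemma d_coef_edge s t e : e \notin edges_of s -> edges_of t = toggle e (edges_of s) ->
  d_coef s t = sgn (edges_of s) e * edge_coef s t.
Proof.
move=> es et; rewrite d_coefE (bigD1 e) /=; last by rewrite es et eqxx.
rewrite big1 ?addr0 // => e' /andP[/andP[_ /eqP e't] ne].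
case/eqP: ne; apply/eqP; have := in_toggle e' (edges_of s) e.
by rewrite -e't et in_toggle eqxx /= eq_sym; case: eqVneq => //; case: (_ \in _).
Qed.

Lemma sqr_sgn A e : sgn A e ^+ 2 = 1.
Proof. exact: sqrr_sign. Qed.

Lemma d_coef_neq0 s t : d_coef s t != 0 ->
  exists e, [/\ e \notin edges_of s, edges_of t = toggle e (edges_of s)
             & edge_coef s t != 0].
Proof.
have [/existsP[e /andP[es /eqP et]]|] :=
    boolP [exists e, (e \notin edges_of s) && (edges_of t == toggle e (edges_of s))].
  rewrite (d_coef_edge es et) mulf_eq0 negb_or => /andP[_ nz].
  by exists e.
rewrite negb_exists => /forallP no; rewrite d_coefE big1 ?eqxx // => e.
by rewrite (negbTE (no e)).
Qed.

Lemma edge_coef_label s t C : edge_coef s t != 0 ->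
  C \in comps_of s -> C \in comps_of t -> label s C = label t C.
Proof.
rewrite /edge_coef; case: ifP => [/forall_inP h _ Cs Ct|]; last by rewrite eqxx.
by apply/eqP; apply: h; rewrite inE Cs.
Qed.

Lemma hdeg_d s t : d_coef s t != 0 -> hdeg t = hdeg s + 1.
Proof.
by case/d_coef_neq0=> e [es et _]; rewrite /hdeg et toggleU // cardsU1 es PoszD addrC.
Qed.

Lemma qdegE s : qdeg s =
  \sum_(C in comps_of s) (if label s C then 1 else -1) + hdeg s.
Proof.
congr (_ + _); rewrite (big_setID (plus_of s)) /=; congr (_ + _).
  have -> : comps_of s :&: plus_of s = plus_of s.
    by apply/setIidPr/subsetP=> C; exact: plus_sub.
  by rewrite -natz -sumr_const; apply: eq_bigr => C Cs; rewrite /label Cs.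
rewrite -natz -mulNrn -sumr_const; apply: eq_bigr => C.
by rewrite !inE /label => /andP[/negbTE->].
Qed.

Lemma qdeg_d s t : d_coef s t != 0 -> qdeg t = qdeg s.
Proof.
move=> nd; have hd := hdeg_d nd; have [e [es et]] := d_coef_neq0 nd.
rewrite !qdegE {}hd /edge_coef.
case: ifP => [/forall_inP lE|]; last by rewrite eqxx.
have sumD (F : {set corner G} -> int) (X Y : {set {set corner G}}) :
    \sum_(C in X) F C = \sum_(C in X :&: Y) F C + \sum_(C <- enum (X :\: Y)) F C.
  by rewrite (big_setID Y) /= big_enum.
have eI : \sum_(C in comps_of t :&: comps_of s) (if label t C then 1 else -1) =
    \sum_(C in comps_of s :&: comps_of t) (if label s C then 1 else -1) :> int.
  by rewrite setIC; apply: eq_bigr => C /lE/eqP->.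
rewrite (sumD _ _ (comps_of s)) [in RHS](sumD _ _ (comps_of t)) eI.
case: (enum (comps_of s :\: _)) => [|C1 [|C2 [|C3 ?]]];
  case: (enum (comps_of t :\: _)) => [|D1 [|D2 [|D3 ?]]]; rewrite ?eqxx //
  !big_cons !big_nil; case: (label s _); try case: (label s _);
  case: (label t _); try case: (label t _); rewrite /m_coef /Delta_coef /= ?eqxx // => _; ring.
Qed.

(** The reduced chains form a subcomplex: the products and coproducts of v_- have
    v_- in every factor. *)
Lemma lab_marked_d s t p : d_coef s t != 0 -> ~~ lab s p -> ~~ lab t p.
Proof.
case/d_coef_neq0=> e [_ et] nz sp.
case je: (joins (edges_of s) e).
  move: nz; rewrite (edge_coef_split et je); case: ifP; last by rewrite eqxx.
  move=> /forallP h; have [pa|na] := boolP (p \in orb (edges_of s) (side e false)); last first.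
    by have := h p; rewrite na => /eqP->.
  rewrite -(lab_orb pa) (negbTE sp) /Delta_coef.
  have eA : edges_of s = toggle e (edges_of t) by rewrite et toggleK.
  have nj : ~~ joins (edges_of t) e by rewrite et joins_toggle je.
  move: pa; rewrite eA orb_side // inE => /orP[]/lab_orb->;
    by do 2 case: (lab t _).
move: nz; rewrite (edge_coef_merge et) ?je //; case: ifP; last by rewrite eqxx.
move=> /forallP h; have [pa|na] := boolP (p \in orb (edges_of t) (side e false)); last first.
  by have := h p; rewrite na => /eqP<-.
rewrite (lab_orb pa); move: pa; rewrite et orb_side ?je // inE.
by case/orP=> /lab_orb e1; move: sp; rewrite e1; case: (lab s _); case: (lab s _) => //;
  case: (lab t _).
Qed.

End Degrees.

(** * A free edge touching a leaf *)

Section Leaf.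

Variable G : ribbonGraph.

Local Notation edge := 'I_(nedges G).
Implicit Types (A B : {set edge}) (e : edge) (c : corner G).
Implicit Types (C D W : {set corner G}).

Definition btw (A0 A1 A : {set edge}) := (A0 \subset A) && (A \subset A1).

Lemma btw_toggle A0 A1 A e : e \in A1 :\: A0 -> btw A0 A1 A ->
  btw A0 A1 (toggle e A).
Proof.
rewrite inE => /andP[e0 e1] /andP[/subsetP s0 /subsetP s1].
apply/andP; split; apply/subsetP=> i; rewrite in_toggle.
  by case: eqVneq => [->|_ /s0]; rewrite ?(negbTE e0).
by case: eqVneq => [->|_ /s1].
Qed.

Lemma stable_cover A (Z : {set {set corner G}}) :
  Z \subset bcomps A -> stable (boundary A) (cover Z).
Proof.
move=> /subsetP ZA c; apply/bigcupP/bigcupP=> -[C CZ cC]; exists C => //.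
  by move: cC; have /bcompsP[x ->] := ZA C CZ; rewrite /orb stable_porbit.
by move: cC; have /bcompsP[x ->] := ZA C CZ; rewrite /orb stable_porbit.
Qed.

Lemma stable_toggle A e W : (side e false \in W) = (side e true \in W) ->
  stable (boundary A) W -> stable (boundary (toggle e A)) W.
Proof. by move=> h sW; rewrite boundary_toggle; exact: stable_mul_tperm. Qed.

Lemma stable_orb A c : stable (boundary A) (orb A c).
Proof. exact: stable_porbit. Qed.

Lemma orb_subset A c W : stable (boundary A) W -> c \in W -> orb A c \subset W.
Proof. exact: porbit_sub. Qed.

(** Z consists of boundary components common to all edge sets of the interval, K
    is the union of the other components, and the quasi-trees relative to Z are
    the edge sets for which K is a single component. *)
Variables (A0 A1 : {set edge}) (Z : {set {set corner G}}) (p : corner G).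
Variable T : {set edge}.

Let K := ~: cover Z.

Hypothesis ZA : forall A, btw A0 A1 A -> Z \subset bcomps A.
Hypothesis pK : p \in K.
Hypothesis bT : btw A0 A1 T.
Hypothesis KT : K \in bcomps T.
Hypothesis uniqT : forall e A, e \in A1 :\: A0 -> btw A0 A1 A ->
  K \in bcomps A -> (e \in A) = (e \in T).

Lemma stableK A : btw A0 A1 A -> stable (boundary A) K.
Proof. by move=> /ZA/stable_cover sA c; rewrite !inE sA. Qed.

Lemma orbTK c : c \in K -> orb T c = K.
Proof. by move=> cK; apply/eqP; rewrite eq_sym -bcompsE. Qed.

Lemma toggleT_notin e : e \in A1 :\: A0 -> K \notin bcomps (toggle e T).
Proof.
move=> eF; apply/negP=> /(uniqT eF (btw_toggle eF bT)).
by rewrite in_toggle eqxx; case: (e \in T).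
Qed.

Lemma side_in_K e b : e \in A1 :\: A0 -> side e b \in K.
Proof.
move=> eF; apply: contraT => nb; case/negP: (toggleT_notin eF).
have sK := stableK (btw_toggle eF bT).
suff nbK b' : side e b' \notin K.
  by rewrite (bcompsE _ pK) orb_id // orbTK ?nbK.
have [<- //|bb'] := eqVneq b b'; apply: contra nb => b'K.
have [jT|njT] := boolP (joins T e).
  rewrite -(orbTK b'K) -eq_orb; move: jT; rewrite /joins -eq_orb.
  by case: (b) bb'; case: (b') => // _; rewrite // eq_sym.
apply: (subsetP (orb_subset sK b'K)); rewrite orb_side //.
by case: (b); rewrite !inE mem_orb ?orbT.
Qed.

Lemma joinsT e : e \in A1 :\: A0 -> joins T e.
Proof. by move=> eF; rewrite /joins orbTK side_in_K. Qed.

Lemma not_joins_toggleT e : e \in A1 :\: A0 -> ~~ joins (toggle e T) e.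
Proof. by move=> eF; rewrite joins_toggle joinsT. Qed.

Lemma K_split e : e \in A1 :\: A0 ->
  K = orb (toggle e T) (side e false) :|: orb (toggle e T) (side e true).
Proof.
move=> eF; rewrite -(orb_side false (not_joins_toggleT eF)) toggleK.
by rewrite orbTK ?side_in_K.
Qed.

(** Toggling e cuts K in two, and the lobe is the part without the marked point;
    [lobe_side] says which side of the band it meets. *)
Definition lobe_side e := p \in orb (toggle e T) (side e false).

Definition lobe e := orb (toggle e T) (side e (lobe_side e)).

Lemma lobe_compl e : e \in A1 :\: A0 ->
  K :\: lobe e = orb (toggle e T) (side e (~~ lobe_side e)).
Proof.
move=> eF; have := not_joins_toggleT eF; rewrite /joins => nj.
have dis c : c \in orb (toggle e T) (side e false) ->
    c \notin orb (toggle e T) (side e true).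
  by move=> ca; apply: contra nj => cb; rewrite -eq_orb -(orbE ca) -(orbE cb).
rewrite (K_split eF) /lobe; apply/setP=> c; rewrite !inE.
have := dis c; case: (lobe_side e) => /=;
  case: (boolP (c \in orb _ (side e false))) => [_ /(_ isT)/negbTE->|_ _] //=.
by case: (c \in _).
Qed.

Lemma p_notin_lobe e : e \in A1 :\: A0 -> p \notin lobe e.
Proof.
move=> eF; have : p \in K :\: lobe e; last by rewrite inE => /andP[].
rewrite lobe_compl //; move: pK; rewrite (K_split eF) inE /lobe_side.
by case pa: (p \in orb _ (side e false)).
Qed.

Lemma lobe_sub e : e \in A1 :\: A0 -> lobe e \subset K.
Proof.
by move=> eF; rewrite (K_split eF) /lobe; case: lobe_side; rewrite ?subsetUl ?subsetUr.
Qed.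

Lemma side_in_lobe e b : e \in A1 :\: A0 -> (side e b \in lobe e) = (b == lobe_side e).
Proof.
move=> eF; case: eqVneq => [->|ne]; first exact: mem_orb.
have : side e b \in K :\: lobe e; last by rewrite inE => /andP[/negbTE].
rewrite lobe_compl //; suff -> : ~~ lobe_side e = b by exact: mem_orb.
by move: ne; case: (b); case: lobe_side.
Qed.

(** Otherwise toggling both edges would reconnect K, and give a quasi-tree on which
    e has not its value in T. *)
Lemma lobe_uncrossed e e' : e \in A1 :\: A0 -> e' \in A1 :\: A0 -> e != e' ->
  (side e' false \in lobe e) = (side e' true \in lobe e).
Proof.
move=> eF e'F ne; apply/eqP; apply: contraT => cross.
have bTe := btw_toggle eF bT.
have nj : ~~ joins (toggle e T) e'.
  apply: contra cross => /orbE j.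
  by rewrite /lobe -!eq_orb j.
have orbK c : c \in K -> c \notin lobe e -> orb (toggle e T) c = K :\: lobe e.
  move=> cK nc; rewrite lobe_compl //; apply/orbE.
  by rewrite -lobe_compl // inE nc.
have aK := side_in_K false e'F; have bK := side_in_K true e'F.
have : K \in bcomps (toggle e' (toggle e T)).
  rewrite (bcompsE _ aK) orb_side //.
  have KE : K = lobe e :|: (K :\: lobe e).
    apply/setP=> c; rewrite in_setU in_setD.
    by case: (boolP (c \in lobe e)) => //= /(subsetP (lobe_sub eF)).
  move: cross; case: (boolP (side e' false \in lobe e)) => h1;
    case: (boolP (side e' true \in lobe e)) => h2 // _.
    by rewrite (orbK _ bK h2) (orbE h1) -/(lobe e) -KE.
  by rewrite (orbK _ aK h1) (orbE h2) -/(lobe e) setUC -KE.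
move/(uniqT eF (btw_toggle e'F bTe)).
by rewrite !in_toggle eqxx (negbTE ne) /=; case: (e \in T).
Qed.

Lemma stable_lobe2 e e' : e \in A1 :\: A0 -> e' \in A1 :\: A0 -> e != e' ->
  stable (boundary (toggle e' (toggle e T))) (lobe e).
Proof.
move=> eF e'F ne; apply: stable_toggle (lobe_uncrossed eF e'F ne) _.
exact: stable_orb.
Qed.

(** A set that is stable after both toggles and avoids the sides of both bands is
    stable for T, of which K is a single cycle. *)
Lemma untouched_trivial e e' W c : e \in A1 :\: A0 -> e' \in A1 :\: A0 ->
  stable (boundary (toggle e' (toggle e T))) W ->
  (forall b, side e b \notin W) -> (forall b, side e' b \notin W) ->
  c \in K -> c \notin W.
Proof.
move=> eF e'F sW n1 n2 cK.
have sT : stable (boundary T) W.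
  rewrite -(toggleK e T) -(toggleK e' (toggle e T)).
  apply: stable_toggle; first by rewrite !(negbTE (n1 _)).
  by apply: stable_toggle; first by rewrite !(negbTE (n2 _)).
apply: contra (n1 false) => cW.
by apply: (subsetP (orb_subset sT cW)); rewrite orbTK ?side_in_K.
Qed.

(** Both lobes are stable after both toggles.  If the lobe of e' were not inside the
    lobe of e, one of two nonempty sets would avoid the sides of both bands, against
    the previous lemma: their difference, or the complement in K of their union,
    which contains p. *)
Lemma lobe_nested e e' b : e \in A1 :\: A0 -> e' \in A1 :\: A0 -> e != e' ->
  side e' b \in lobe e -> lobe e' \proper lobe e.
Proof.
move=> eF e'F ne e'b.
have e'all b' : side e' b' \in lobe e.
  by have := lobe_uncrossed eF e'F ne; case: b e'b; case: b' => // ->.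
have s1 := stable_lobe2 eF e'F ne.
have s2 : stable (boundary (toggle e' (toggle e T))) (lobe e').
  by rewrite toggleC; apply: stable_lobe2 => //; rewrite eq_sym.
have e2 : (side e false \in lobe e') = (side e true \in lobe e').
  by apply: lobe_uncrossed => //; rewrite eq_sym.
have sub : lobe e' \subset lobe e.
  apply/subsetP=> c ce'; apply: contraT => nce.
  have cK : c \in K by apply: (subsetP (lobe_sub e'F)).
  have [ain|nain] := boolP (side e false \in lobe e'); last first.
    have : c \notin lobe e' :\: lobe e.
      apply: (@untouched_trivial e e') => //; first exact: stableD.
        by case; rewrite inE ?(negbTE nain) -?e2 ?(negbTE nain) andbF.
      by move=> b'; rewrite inE e'all.
    by rewrite inE nce ce'.
  have sK := stableK (btw_toggle e'F (btw_toggle eF bT)).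
  have : p \notin K :\: (lobe e :|: lobe e').
    apply: (@untouched_trivial e e') => //; first by apply: stableD; [|exact: stableU].
      by case; rewrite !inE -?e2 ain orbT.
    by move=> b'; rewrite !inE e'all.
  by rewrite in_setD in_setU pK (negbTE (p_notin_lobe eF)) (negbTE (p_notin_lobe e'F)).
apply/properP; split=> //; exists (side e' (~~ lobe_side e')) => //.
by rewrite side_in_lobe //; case: lobe_side.
Qed.

(** A lobe with the fewest corners contains no side of another free edge, so it is
    a boundary component for all edge sets on the same side of e as the toggled
    T. *)
Lemma exists_leaf : A1 :\: A0 != set0 -> exists e b D,
  [/\ e \in A1 :\: A0, D \subset K, p \notin D, side e b \in D & side e (~~ b) \in K :\: D] /\
  [/\ forall A, btw A0 A1 A -> (e \in A) != (e \in T) -> D \in bcomps A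
    & K :\: D \in bcomps (toggle e T)].
Proof.
case/set0Pn=> e0 e0F.
pose e := [arg min_(e < e0 in A1 :\: A0) #|lobe e|].
have [eF emin] : e \in A1 :\: A0 /\
    forall e', e' \in A1 :\: A0 -> (#|lobe e| <= #|lobe e'|)%N.
  by rewrite /e; case: arg_minnP.
have untouched e' b : e' \in A1 :\: A0 -> e != e' -> side e' b \notin lobe e.
  move=> e'F ne; apply/negP=> /(lobe_nested eF e'F ne)/proper_card.
  by have := emin e' e'F; lia.
exists e, (lobe_side e), (lobe e); split; first split.
- exact: eF.
- exact: lobe_sub.
- exact: p_notin_lobe.
- exact: mem_orb.
- by rewrite lobe_compl // mem_orb.
split; last by rewrite lobe_compl // mem_bcomps.
move=> A /andP[/subsetP s0 /subsetP s1] eA.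
have /andP[/subsetP t0 /subsetP t1] := bT.
suff -> : lobe e = orb A (side e (lobe_side e)) by exact: mem_bcomps.
apply/esym/(@eq_porbit_on _ _ _ (lobe e)); [exact: stable_orb|exact: mem_orb|].
move=> c cD; have : boundary (toggle e T) c \in lobe e by rewrite stable_orb.
rewrite !permE; case: c {cD} => [h|v] //=.
case: (Defs.rot G h) => i b; rewrite /flip /= in_toggle.
have [->|ne] := eqVneq i e.
  by move: eA; case: (e \in T); case: (e \in A).
rewrite /=; case: (boolP (i \in A1 :\: A0)) => [iF|].
  rewrite eq_sym in ne.
  by case: ifP => _ /negPn; rewrite untouched.
rewrite inE negb_and negbK => /orP[i0|i1]; first by rewrite t0 // s0.
by rewrite !ifN //; [apply: contra i1; exact: s1|apply: contra i1; exact: t1].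
Qed.

End Leaf.

(** * Removing a leaf from the complex *)

Section Peel.

Variable G : ribbonGraph.

Local Notation edge := 'I_(nedges G).
Implicit Types (A B : {set edge}) (e : edge) (c : corner G).
Implicit Types (C D W : {set corner G}) (r s t : state G) (l : bool).

(** A leaf: the edge e joins the component D, present for one of the two values of
    e, to the rest of the surface.  Below, r is a state for this value of e. *)
Variables (e : edge) (b : bool) (D : {set corner G}).

Local Notation u := (side e b).
Local Notation v := (side e (~~ b)).

Hypothesis uD : u \in D.
Hypothesis vD : v \notin D.

Lemma leafE A : D \in bcomps A -> D = orb A u.
Proof. by rewrite (bcompsE _ uD) => /eqP. Qed.

Lemma leaf_not_joins A : D \in bcomps A -> ~~ joins A e.
Proof.
move=> /leafE eD; move: vD; rewrite eD /joins; case: (b) => //.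
by rewrite orb_sym.
Qed.

Lemma orb_leaf A b' : D \in bcomps A ->
  orb (toggle e A) (side e b') = D :|: orb A v.
Proof.
move=> DA; rewrite orb_side ?leaf_not_joins //.
rewrite {1}(leafE DA).
by case: (b); rewrite // setUC.
Qed.

Lemma lab_leaf r c : D \in bcomps (edges_of r) -> c \in D -> lab r c = lab r u.
Proof.
by move=> DA; rewrite (leafE DA); exact: lab_orb.
Qed.

Definition agree r s := [forall c, (c \notin D) ==> (lab r c == lab s c)].

Lemma agreeE r s : D \in bcomps (edges_of r) -> edges_of s = toggle e (edges_of r) ->
  agree r s =
  [forall c, (c \notin orb (edges_of s) (side e false)) ==> (lab r c == lab s c)]
  && (lab r v == lab s v).
Proof.
move=> DA es; rewrite es orb_leaf //; apply/forallP/andP=> [h|[/forallP h1 h2] c].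
  split; last by have := h v; rewrite vD.
  apply/forallP=> c; apply/implyP; rewrite inE negb_or => /andP[nc _].
  by have := h c; rewrite nc.
apply/implyP=> nc; have [cv|ncv] := boolP (c \in orb (edges_of r) v).
  rewrite (lab_orb cv) (eqP h2); apply/eqP/esym/lab_orb.
  by rewrite es orb_leaf // inE cv orbT.
by have := h1 c; rewrite inE (negbTE nc) (negbTE ncv).
Qed.

(** When the leaf is labelled v_-, the split map has only the term that keeps the
    label of the other part. *)
Lemma edge_coef_into_leaf r s : D \in bcomps (edges_of r) ->
  edges_of s = toggle e (edges_of r) -> ~~ lab r u ->
  edge_coef s r = (agree r s)%:R.
Proof.
move=> DA es ru; have er : edges_of r = toggle e (edges_of s) by rewrite es toggleK.
rewrite (edge_coef_split er); last by rewrite es joins_toggle leaf_not_joins.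
rewrite agreeE //; case: ifP => //= _.
have -> : Delta_coef (lab s (side e false)) (lab r (side e false)) (lab r (side e true))
    = Delta_coef (lab s v) (lab r u) (lab r v).
  have -> : lab s (side e false) = lab s v.
    by apply: lab_orb; rewrite es -eq_orb !orb_leaf.
  by case: (b); rewrite // Delta_coefC.
by rewrite (negbTE ru); case: (lab s v); case: (lab r v).
Qed.

(** When the leaf is labelled v_+, the unit, the merge map keeps the label of the
    other component. *)
Lemma edge_coef_from_leaf r s : D \in bcomps (edges_of r) ->
  edges_of s = toggle e (edges_of r) -> lab r u ->
  edge_coef r s = (agree r s)%:R.
Proof.
move=> DA es ru; rewrite (edge_coef_merge es) ?leaf_not_joins //.
rewrite agreeE //; case: ifP => //= _.
have -> : m_coef (lab r (side e false)) (lab r (side e true)) (lab s (side e false))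
    = m_coef (lab r u) (lab r v) (lab s v).
  have -> : lab s (side e false) = lab s v.
    by apply: lab_orb; rewrite es -eq_orb !orb_leaf.
  by case: (b); rewrite // m_coefC.
by rewrite ru; case: (lab s v); case: (lab r v).
Qed.

(** The bijections between the states without the leaf and the states with the leaf
    labelled l. *)
Definition unpeel r : state G :=
  mk_state (toggle e (edges_of r)) (fun c => lab r (if c \in D then v else c)).

Definition peel l s : state G :=
  mk_state (toggle e (edges_of s)) (fun c => if c \in D then l else lab s c).

Lemma edges_unpeel r : edges_of (unpeel r) = toggle e (edges_of r).
Proof. exact: edges_mk_state. Qed.

Lemma edges_peel l s : edges_of (peel l s) = toggle e (edges_of s).
Proof. exact: edges_mk_state. Qed.

Lemma leaf_orb A c c' : D \in bcomps A -> c \in orb A c' -> (c \in D) = (c' \in D).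
Proof.
by move=> DA cc'; rewrite (leafE DA) -!eq_orb (orbE cc').
Qed.

Lemma lab_unpeel r c : D \in bcomps (edges_of r) ->
  lab (unpeel r) c = lab r (if c \in D then v else c).
Proof.
move=> DA; rewrite lab_mk_state // => {}c c' cc'.
have [c'U|nc'] := boolP (c' \in orb (toggle e (edges_of r)) (side e false)).
  suff h x : x \in orb (toggle e (edges_of r)) (side e false) ->
      lab r (if x \in D then v else x) = lab r v.
    by rewrite !h // -eq_orb (orbE cc') eq_orb.
  rewrite orb_leaf // inE; case: (x \in D) => //= xv; exact: lab_orb.
move: cc'; rewrite (orb_id' (leaf_not_joins DA) nc') => cc'.
rewrite (leaf_orb DA cc'); case: ifP => // _; exact: lab_orb.
Qed.

Lemma lab_peel l s c : D \in bcomps (toggle e (edges_of s)) ->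
  lab (peel l s) c = if c \in D then l else lab s c.
Proof.
move=> DA; rewrite lab_mk_state // => {}c c' cc'.
rewrite (leaf_orb DA cc'); case: ifP => // c'D; apply: lab_orb.
have [c'U|nc'] := boolP (c' \in orb (edges_of s) (side e false)); last first.
  move: cc' nc'; rewrite -{2}(toggleK e (edges_of s)) => cc' nc'.
  by rewrite -[edges_of s](toggleK e) (orb_id' (leaf_not_joins DA) nc').
rewrite -eq_orb (orbE c'U) eq_orb.
move: c'U; rewrite -[edges_of s](toggleK e) orb_leaf // !inE (leaf_orb DA cc') c'D /=.
by rewrite -!eq_orb (orbE cc').
Qed.

Lemma agree_unpeel r : D \in bcomps (edges_of r) -> agree r (unpeel r).
Proof.
by move=> DA; apply/forallP=> c; apply/implyP=> nc; rewrite lab_unpeel // (negbTE nc).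
Qed.

Lemma agree_peel l s : D \in bcomps (toggle e (edges_of s)) -> agree (peel l s) s.
Proof.
by move=> DA; apply/forallP=> c; apply/implyP=> nc; rewrite lab_peel // (negbTE nc).
Qed.

Lemma agree_unpeelE r s : D \in bcomps (edges_of r) ->
  edges_of s = toggle e (edges_of r) -> agree r s -> s = unpeel r.
Proof.
move=> DA es ag; apply: state_eq => [|c]; first by rewrite edges_unpeel.
rewrite lab_unpeel //; case: ifP => cD; last first.
  by have /forallP/(_ c) := ag; rewrite cD => /eqP.
have /forallP/(_ v) := ag; rewrite vD => /eqP->; apply: lab_orb.
by rewrite es orb_leaf // inE cD.
Qed.

Lemma agree_peelE l r s : D \in bcomps (edges_of r) ->
  edges_of s = toggle e (edges_of r) -> lab r u = l -> agree r s -> r = peel l s.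
Proof.
move=> DA es ru ag; have er : edges_of r = toggle e (edges_of s) by rewrite es toggleK.
apply: state_eq => [|c]; first by rewrite edges_peel.
rewrite lab_peel -?er //; case: ifP => cD; first by rewrite lab_leaf.
by have /forallP/(_ c) := ag; rewrite cD => /eqP.
Qed.

Lemma unpeelK r : D \in bcomps (edges_of r) -> peel (lab r u) (unpeel r) = r.
Proof.
move=> DA; apply/esym/agree_peelE; rewrite ?edges_unpeel //.
exact: agree_unpeel.
Qed.

Lemma peelK l s : D \in bcomps (toggle e (edges_of s)) -> unpeel (peel l s) = s.
Proof.
move=> DA; apply/esym/agree_unpeelE; rewrite ?edges_peel ?toggleK //.
exact: agree_peel.
Qed.

End Peel.

(** * Acyclicity away from the quasi-trees *)

Section Parts.

Variable G : ribbonGraph.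

Local Notation edge := 'I_(nedges G).
Implicit Types (A B : {set edge}) (e : edge) (c : corner G).
Implicit Types (C D W : {set corner G}) (r s t : state G) (l : bool).
Implicit Types (Z P : {set {set corner G}}) (X S : pred (state G)) (i q : int).

Variable p : corner G.

(** The states over an interval of the cube whose label is v_+ on the components
    of P and v_- on the other components of Z and on the marked component. *)
Definition part A0 A1 Z P : pred (state G) := fun s =>
  [&& btw A0 A1 (edges_of s), plus_of s :&: Z == P & ~~ lab s p].

Definition exact_states X i q := exact_at (@d_coef G) (@hdeg G) (@qdeg G) X i q.

Definition convex_states X := convex (@d_coef G) X.

Definition closed_in X S := forall s t, S s -> X t -> d_coef s t != 0 -> S t.

Lemma convex_closed X S : convex_states X -> (forall s, S s -> X s) -> closed_in X S ->
  convex_states S.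
Proof.
move=> cX SX clS s r t Ss St sr rt.
by apply: (clS s) => //; exact: cX (SX _ Ss) (SX _ St) sr rt.
Qed.

Lemma convex_compl X S : convex_states X -> closed_in X S ->
  convex_states (fun s => X s && ~~ S s).
Proof.
move=> cX clS s r t /andP[Xs nSs] /andP[Xt nSt] sr rt; apply/andP; split.
  exact: cX Xs Xt sr rt.
by apply: contra nSt => Sr; exact: clS Sr Xt rt.
Qed.

Lemma d_coef_sub s t : d_coef s t != 0 -> edges_of s \subset edges_of t.
Proof. by case/d_coef_neq0=> e [es -> _]; rewrite toggleU // subsetUr. Qed.

Definition frozen A0 A1 Z := forall A, btw A0 A1 A -> Z \subset bcomps A.

Lemma btw_trans A0 A1 A B A' : btw A0 A1 A -> btw A0 A1 A' ->
  A \subset B -> B \subset A' -> btw A0 A1 B.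
Proof.
by move=> /andP[h1 _] /andP[_ h2] h3 h4; rewrite /btw (subset_trans h1) // (subset_trans h4).
Qed.

Lemma part_d A0 A1 Z P s t : frozen A0 A1 Z -> part A0 A1 Z P s ->
  btw A0 A1 (edges_of t) -> d_coef s t != 0 -> part A0 A1 Z P t.
Proof.
move=> fZ /and3P[bs /eqP sP sp] bt nd.
rewrite /part bt (lab_marked_d nd sp) andbT /= -sP; apply/eqP/setP=> C.
rewrite !inE; case CZ: (C \in Z); rewrite ?andbF // !andbT.
have [e [_ _ nz]] := d_coef_neq0 nd.
by apply/esym/(edge_coef_label nz); apply: (subsetP (fZ _ _)).
Qed.

Lemma convex_part A0 A1 Z P : frozen A0 A1 Z -> convex_states (part A0 A1 Z P).
Proof.
move=> fZ s r t Ss St sr rt; apply: (part_d fZ Ss _ sr).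
case/and3P: Ss => bs _ _; case/and3P: St => bt _ _.
exact: btw_trans bs bt (d_coef_sub sr) (d_coef_sub rt).
Qed.

Lemma part_agree A0 A1 Z P D r s : frozen A0 A1 Z -> D \subset ~: cover Z ->
  p \notin D -> btw A0 A1 (edges_of r) -> btw A0 A1 (edges_of s) -> agree D r s ->
  part A0 A1 Z P r = part A0 A1 Z P s.
Proof.
move=> fZ DK pD br bs /forallP ag; rewrite /part br bs /=.
have := ag p; rewrite pD => /eqP ->; congr (_ && _); congr (_ == _).
apply/setP=> C; rewrite !inE; case CZ: (C \in Z); rewrite ?andbF // !andbT.
have /subsetP/(_ C CZ)/bcompsP[c eC] := fZ _ br.
have /subsetP/(_ C CZ) := fZ _ bs; have cC : c \in C by rewrite eC mem_orb.
rewrite (bcompsE _ cC) => /eqP eC'.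
have nc : c \notin D.
  apply/negP=> /(subsetP DK); rewrite inE => /negP; apply; apply/bigcupP.
  by exists C.
have := ag c; rewrite nc => /eqP; rewrite /lab -eC -eC'.
by rewrite /label.
Qed.

Lemma btw_e1 A0 A1 A e : btw (e |: A0) A1 A = btw A0 A1 A && (e \in A).
Proof. by rewrite /btw subUset sub1set -andbA andbC -andbA. Qed.

Lemma btw_e0 A0 A1 A e : btw A0 (A1 :\ e) A = btw A0 A1 A && (e \notin A).
Proof. by rewrite /btw subsetD1 andbA. Qed.

Lemma free_e1 A0 A1 e : e \in A1 :\: A0 ->
  (#|A1 :\: (e |: A0)| < #|A1 :\: A0|)%N.
Proof.
move=> eF; rewrite [X in (_ < X)%N](cardsD1 e) eF add1n ltnS.
by apply: subset_leq_card; apply/subsetP=> x; rewrite !inE negb_or -andbA.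
Qed.

Lemma free_e0 A0 A1 e : e \in A1 :\: A0 ->
  (#|(A1 :\ e) :\: A0| < #|A1 :\: A0|)%N.
Proof.
move=> eF; rewrite [X in (_ < X)%N](cardsD1 e) eF add1n ltnS.
by apply: subset_leq_card; apply/subsetP=> x; rewrite !inE => /and3P[-> -> ->].
Qed.

Lemma coef_step s t e : e \notin edges_of s -> e \in edges_of t ->
  d_coef s t != 0 -> edges_of t = toggle e (edges_of s) /\ edge_coef s t != 0.
Proof.
move=> es et /d_coef_neq0[e' [_ est nz]]; split=> //; rewrite est; congr toggle.
by move: et; rewrite est in_toggle (negbTE es) addbF => /eqP.
Qed.

(** The number 2 |P| - |Z| - |A| is 2 delta for the state over A whose components
    are K and those of Z, with v_+ exactly on P.  Freezing a leaf labelled v_- while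
    removing its edge, or labelled v_+ while adding it, does not change it. *)
Lemma value_state (x y k : nat) : (x <= y)%N ->
  x%:Z - (1 + y - x)%N%:Z + k%:Z + 1 - k%:Z - k%:Z = x%:Z + x%:Z - y%:Z - k%:Z.
Proof. by move=> h; lia. Qed.

Lemma value_minus (x y k : nat) :
  x%:Z + x%:Z - y.+1%:Z - k%:Z = x%:Z + x%:Z - y%:Z - (1 + k)%N%:Z.
Proof. by lia. Qed.

Lemma value_plus (x y k : nat) :
  (1 + x)%N%:Z + (1 + x)%N%:Z - y.+1%:Z - (1 + k)%N%:Z = x%:Z + x%:Z - y%:Z - k%:Z.
Proof. by lia. Qed.

(** Homology can be nonzero in bidegree (i, q) only if 2 delta = q + 1 - 2 i is the
    value of some relative quasi-tree of the interval; the shift by 1 is that of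
    the reduced theory. *)
Lemma exact_part A0 A1 Z P i q : A0 \subset A1 -> frozen A0 A1 Z -> P \subset Z ->
  p \notin cover Z ->
  (exists2 T, btw A0 A1 T & ~: cover Z \in bcomps T) ->
  (forall A, btw A0 A1 A -> ~: cover Z \in bcomps A ->
     q + 1 - i - i != #|P|%:Z + #|P|%:Z - #|Z|%:Z - #|A|%:Z) ->
  exact_states (part A0 A1 Z P) i q.
Proof.
have [n] := ubnP #|A1 :\: A0|; elim: n A0 A1 Z P => // n IHn A0 A1 Z P.
rewrite ltnS => len sA fZ sP pZ [T bT KT] crit.
have pK : p \in ~: cover Z by rewrite inE.
have cX := convex_part (P := P) fZ.
have [/existsP[e /existsP[A /and4P[eF bA KA eA]]]|] :=
    boolP [exists e, [exists A, [&& e \in A1 :\: A0, btw A0 A1 A,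
      ~: cover Z \in bcomps A & (e \in A) != (e \in T)]]].
  (* both halves of the interval, without and with e, contain quasi-trees *)
  have [e0 e1] : (e \notin A0) /\ (e \in A1) by move: eF; rewrite inE => /andP.
  have in1 : exists2 B, btw (e |: A0) A1 B & ~: cover Z \in bcomps B.
    case eT: (e \in T) eA => eA; first by exists T; rewrite // btw_e1 bT.
    by exists A => //; rewrite btw_e1 bA; case: (e \in A) eA.
  have in0 : exists2 B, btw A0 (A1 :\ e) B & ~: cover Z \in bcomps B.
    case eT: (e \in T) eA => eA; last by exists T; rewrite // btw_e0 bT eT.
    by exists A => //; rewrite btw_e0 bA; case: (e \in A) eA.
  apply: (@exact_at_filtration _ _ _ _ (@d_coef_d_coef G) (@hdeg_d G) (@qdeg_d G)
     _ (part A0 (A1 :\ e) Z P) (part (e |: A0) A1 Z P)) => //.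
  - move=> s; rewrite /part btw_e0 btw_e1.
    by case: (btw _ _ _) => //=; case: (e \in _) => //=; rewrite addbF.
  - by move=> s; rewrite /part btw_e1 -andbA => /and3P[-> _ ->].
  - move=> s t Ss /and3P[bt _ _] nd; apply: (part_d _ Ss _ nd).
      by move=> B; rewrite btw_e1 => /andP[/fZ].
    rewrite btw_e1 bt (subsetP (d_coef_sub nd)) //.
    by move: Ss; rewrite /part btw_e1 => /andP[/andP[]].
  - apply: IHn => //; first exact: leq_trans (free_e0 eF) len.
    + by rewrite subsetD1 sA.
    + by move=> B; rewrite btw_e0 => /andP[/fZ].
    + by move=> B; rewrite btw_e0 => /andP[/crit].
  - apply: IHn => //; first exact: leq_trans (free_e1 eF) len.
    + by rewrite subUset sub1set e1.
    + by move=> B; rewrite btw_e1 => /andP[/fZ].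
    + by move=> B; rewrite btw_e1 => /andP[/crit].
rewrite negb_exists => /forallP nosplit.
have uniqT e A : e \in A1 :\: A0 -> btw A0 A1 A ->
    ~: cover Z \in bcomps A -> (e \in A) = (e \in T).
  move=> eF bA KA; have := nosplit e; rewrite negb_exists => /forallP/(_ A).
  by rewrite eF bA KA /= negbK => /eqP.
have [F0|F0] := eqVneq (A1 :\: A0) set0.
  (* no free edge: the only state is the one over T, whose degrees are excluded *)
  have eA A : btw A0 A1 A -> A = T.
    have e01 : A1 = A0 by apply/eqP; rewrite eqEsubset sA -setD_eq0 F0 eqxx.
    have aux B : btw A0 A1 B -> B = A0.
      by rewrite /btw e01 => /andP[h1 h2]; apply/eqP; rewrite eqEsubset h2.
    by move=> /aux ->; rewrite (aux T).
  move=> z hz _; exists 0 => [s|t Xt]; first by rewrite ffunE eqxx.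
  rewrite /bd big1 => [|s _]; last by rewrite ffunE mul0r.
  apply/esym/eqP; apply: contraT => /hz[_ hi hq].
  case/and3P: Xt => /eA et /eqP tP tp; case/negP: (crit T bT KT).
  have KE : ~: cover Z = orb T p by apply/eqP; rewrite -bcompsE.
  have ZT : Z \subset bcomps T by exact: fZ.
  have nKZ : ~: cover Z \notin Z.
    apply: contra pZ => KZ; apply/bigcupP; by exists (~: cover Z).
  have bTE : bcomps T = ~: cover Z |: Z.
    apply/setP=> C; rewrite !inE; apply/idP/orP=> [CT|[/eqP->//|]]; last first.
      by apply: (subsetP ZT).
    have /bcompsP[c eC] := CT; have cC : c \in C by rewrite eC mem_orb.
    have [cZ|ncZ] := boolP (c \in cover Z); last first.
      have cK : c \in ~: cover Z by rewrite inE.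
      by left; rewrite eC eq_sym -bcompsE.
    right; case/bigcupP: cZ => C' C'Z cC'.
    have := subsetP ZT _ C'Z; rewrite (bcompsE _ cC') => /eqP e'.
    by rewrite eC -e'.
  have tPE : plus_of t = P.
    rewrite -tP; apply/esym/setIidPl/subsetP=> C Ct.
    have := plus_sub Ct; rewrite /comps_of et bTE !inE => /orP[/eqP eC|//].
    by case/negP: tp; rewrite /lab et -KE -eC.
  move: hi hq; rewrite /hdeg /qdeg tPE /comps_of et bTE => <- <-.
  rewrite cardsD (setIidPr _); last by rewrite subsetU // sP orbT.
  by rewrite cardsU1 nKZ (value_state _ (subset_leq_card sP)).
have [e [b [D [[eF DK pD uD vKD] [Dleaf KDT]]]]] := exists_leaf fZ pK bT KT uniqT F0.
have vD : side e (~~ b) \notin D by move: vKD; rewrite inE => /andP[].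
have [e0 e1] : (e \notin A0) /\ (e \in A1) by move: eF; rewrite inE => /andP.
pose Z' := D |: Z; have KZ' : ~: cover Z' = ~: cover Z :\: D.
  by rewrite /Z' /cover bigcup_setU big_set1 setCU setIC -setDE.
have nDZ : D \notin Z.
  apply/negP=> DZ; have := subsetP DK _ uD; rewrite inE => /negP; apply.
  by apply/bigcupP; exists D.
have bE A : btw A0 A1 A -> btw A0 A1 (toggle e A) by exact: btw_toggle.
have leafE A : btw A0 A1 A -> (e \in A) != (e \in T) -> D = orb A (side e b).
  by move=> bA eA; apply/eqP; rewrite -bcompsE // Dleaf.
(* relative quasi-trees of the frozen interval come from those of the interval *)
have regrow A : btw A0 A1 A -> (e \in A) != (e \in T) ->
    ~: cover Z :\: D \in bcomps A -> ~: cover Z \in bcomps (toggle e A).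
  move=> bA eA; rewrite (bcompsE _ vKD) => /eqP KD.
  rewrite (bcompsE _ (subsetP DK _ uD)) (orb_leaf uD vD) ?Dleaf // -KD.
  apply/eqP/setP=> c; rewrite in_setU in_setD.
  by case: (boolP (c \in D)) => //= /(subsetP DK).
have pZ' : p \notin cover Z'.
  by rewrite -in_setC KZ' in_setD pD.
have labD s : btw A0 A1 (edges_of s) -> (e \in edges_of s) != (e \in T) ->
    lab s (side e b) = (D \in plus_of s).
  by move=> bs es; rewrite /lab -(leafE _ bs es).
have clD s t : part A0 A1 Z P s -> part A0 A1 Z P t -> d_coef s t != 0 ->
    (e \in edges_of s) != (e \in T) -> (e \in edges_of t) != (e \in T) ->
    lab s (side e b) = lab t (side e b).
  move=> /and3P[bs _ _] /and3P[bt _ _] nd es et.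
  have [e' [_ _ nz]] := d_coef_neq0 nd; rewrite !labD //.
  by apply: (edge_coef_label nz); exact: Dleaf.
have cardZ' : #|Z'| = #|Z|.+1 by rewrite cardsU1 nDZ.
have partZ' s (P' : {set {set corner G}}) : P' \subset Z' ->
    (plus_of s :&: Z' == P') =
    (plus_of s :&: Z == P' :&: Z) && ((D \in plus_of s) == (D \in P')).
  move=> sP'; apply/eqP/andP=> [<-|[/eqP/setP h1 /eqP h2]].
    split; last by rewrite !inE eqxx andbT.
    apply/eqP/setP=> C; rewrite !inE.
    by case: (C \in Z); rewrite ?andbF // orbT !andbT.
  apply/setP=> C; rewrite !inE; have := h1 C; rewrite !inE.
  have [->|nCD] := eqVneq C D; first by rewrite h2 andbT.
  move=> /= ->; case CZ: (C \in Z); rewrite ?andbT // andbF.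
  apply/esym/negP=> /(subsetP sP'); rewrite !inE CZ orbF; exact/negP.
have fZ1 A2 A3 : (forall A, btw A2 A3 A -> btw A0 A1 A /\ (e \in A) != (e \in T)) ->
    frozen A2 A3 Z'.
  move=> h A /h[bA eA]; rewrite subUset sub1set fZ // andbT; exact: Dleaf.
have PZ : P :&: Z = P by apply/setIidPl.
have nDP : D \notin P by apply: contra nDZ; exact: (subsetP sP).
case eT: (e \in T).
  (* e is in T: the states with e cancel those without e and with v_+ on the leaf,
     in a subcomplex S; the quotient has v_- on the leaf *)
  have inD A : btw A0 (A1 :\ e) A -> btw A0 A1 A /\ (e \in A) != (e \in T).
    by rewrite btw_e0 eT => /andP[-> /negbTE->].
  pose S s := part A0 A1 Z P s && ((e \in edges_of s) || lab s (side e b)).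
  have clS : closed_in (part A0 A1 Z P) S.
    move=> s t /andP[Ss /orP es] St nd; rewrite /S St /=.
    case: (boolP (e \in edges_of t)) => //= et.
    have nes : e \notin edges_of s by apply: contra et; exact: (subsetP (d_coef_sub nd)).
    case: es => [es|]; first by rewrite es in nes.
    by rewrite (clD s t) // eT ?(negbTE et) ?(negbTE nes).
  have SX s : S s -> part A0 A1 Z P s by case/andP.
  apply: (@exact_at_filtration _ _ _ _ (@d_coef_d_coef G) (@hdeg_d G) (@qdeg_d G)
     _ (part A0 (A1 :\ e) Z' P) S) => //.
  - move=> s; rewrite /S /part btw_e0 partZ'; last by rewrite (subset_trans sP) ?subsetUr.
    rewrite PZ (negbTE nDP); case bs: (btw _ _ _) => //=.
    case: (boolP (e \in _)) => //= es; first by rewrite andbT.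
    rewrite labD // ?eT ?(negbTE es) //.
    by case: (_ == P) => //=; case: (D \in _); case: (lab s p).
  - apply: IHn => //; first exact: leq_trans (free_e0 eF) len.
    + by rewrite subsetD1 sA.
    + exact: fZ1 inD.
    + by rewrite (subset_trans sP) ?subsetUr.
    + exists (toggle e T); last by rewrite KZ'.
      by rewrite btw_e0 bE // in_toggle eqxx eT.
    + move=> A bA KA; have [bA' eA] := inD A bA; rewrite KZ' in KA.
      have := crit _ (bE _ bA') (regrow A bA' eA KA).
      have nA : e \notin A by move: bA; rewrite btw_e0 => /andP[].
      by rewrite toggleU // cardsU1 nA cardZ' value_minus.
  pose Y0 s := part A0 A1 Z P s && ((e \notin edges_of s) && lab s (side e b)).
  pose Y1 s := part A0 A1 Z P s && (e \in edges_of s).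
  have DY0 s : Y0 s -> D \in bcomps (edges_of s).
    by case/andP=> /and3P[bs _ _] /andP[es _]; rewrite Dleaf // eT (negbTE es).
  have DY1 s : Y1 s -> D \in bcomps (toggle e (edges_of s)).
    by case/andP=> /and3P[bs _ _] es; rewrite Dleaf ?bE // in_toggle eqxx eT es.
  apply: (@exact_at_cone _ _ _ _ (@d_coef_d_coef G) (@hdeg_d G) (@qdeg_d G)
     _ Y0 Y1 (unpeel e b D) (peel e D true)).
  - exact: convex_closed SX clS.
  - move=> s; rewrite /S /Y0 /Y1 -andb_orr orbC; congr (_ && _).
    by case: (e \in edges_of s); case: (lab s _).
  - move=> s Ys; have Ds := DY0 s Ys; case/andP: Ys => Xs /andP[es _].
    rewrite /Y1 edges_unpeel in_toggle eqxx /= es andbT.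
    case/and3P: (Xs) => bs _ _.
    rewrite -(part_agree P fZ DK pD bs _ (agree_unpeel uD vD Ds)) //.
    by rewrite edges_unpeel bE.
  - move=> s Ys; have Ds := DY1 s Ys; case/andP: Ys => Xs es.
    rewrite /Y0 edges_peel in_toggle eqxx /= es /= (lab_peel uD vD) // uD andbT.
    case/and3P: (Xs) => bs _ _.
    rewrite (part_agree P fZ DK pD _ bs (agree_peel uD vD true Ds)) //.
    by rewrite edges_peel bE.
  - move=> s Ys; have Ds := DY0 s Ys; case/andP: Ys => _ /andP[_ ls].
    by rewrite -[true]ls (unpeelK uD vD).
  - by move=> s Ys; rewrite (peelK uD vD) // DY1.
  - move=> s Ys; have Ds := DY0 s Ys; case/andP: Ys => _ /andP[es ls].
    rewrite (d_coef_edge es) ?edges_unpeel // (edge_coef_from_leaf uD vD) ?edges_unpeel //.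
    by rewrite (agree_unpeel uD vD) // mulr1 sqr_sgn.
  - move=> s t Ys /andP[_ et]; have Ds := DY0 s Ys; case/andP: Ys => _ /andP[es ls].
    case/(coef_step es et) => est; rewrite (edge_coef_from_leaf uD vD) //.
    by case ag: (agree _ _ _) => // _; exact: (agree_unpeelE uD vD).
(* e is not in T: the states with e and with v_+ on the leaf form a subcomplex S; in
   the quotient the states without e cancel those with v_- on the leaf *)
have inD A : btw (e |: A0) A1 A -> btw A0 A1 A /\ (e \in A) != (e \in T).
  by rewrite btw_e1 eT => /andP[-> ->].
pose P' := D |: P; have sP' : P' \subset Z' by rewrite setUS.
pose S := part (e |: A0) A1 Z' P'.
have P'Z : P' :&: Z = P.
  apply/setP=> C; rewrite !inE; case: eqVneq => [->|_] /=.
    by rewrite (negbTE nDZ) (negbTE nDP).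
  by rewrite -{2}PZ inE.
have SE s : S s = part A0 A1 Z P s && ((e \in edges_of s) && lab s (side e b)).
  rewrite /S /part btw_e1 partZ' // P'Z setU11.
  case bs: (btw _ _ _) => //=; case: (boolP (e \in _)) => //= es; last by rewrite andbF.
  rewrite labD ?eT ?es //.
  by case: (_ == P) => //=; case: (D \in _) => //=; rewrite ?andbT ?andbF.
have SX s : S s -> part A0 A1 Z P s by rewrite SE => /andP[].
have clS : closed_in (part A0 A1 Z P) S.
  move=> s t; rewrite !SE => /andP[Ss /andP[es ls]] St nd; rewrite St /=.
  have et := subsetP (d_coef_sub nd) _ es; rewrite et /=.
  by rewrite -(clD s t) // eT ?es ?et.
apply: (@exact_at_filtration _ _ _ _ (@d_coef_d_coef G) (@hdeg_d G) (@qdeg_d G)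
   _ (fun s => part A0 A1 Z P s && ~~ S s) S) => //.
- by move=> s; have := SX s; case: (S s) => [->|_] //=; rewrite ?andbT ?addbF.
- pose Y0 s := part A0 A1 Z P s && (e \notin edges_of s).
  pose Y1 s := part A0 A1 Z P s && ((e \in edges_of s) && ~~ lab s (side e b)).
  have DY0 s : Y0 s -> D \in bcomps (toggle e (edges_of s)).
    case/andP=> /and3P[bs _ _] es.
    by rewrite Dleaf ?bE // in_toggle eqxx eT (negbTE es).
  have DY1 s : Y1 s -> D \in bcomps (edges_of s).
    by case/andP=> /and3P[bs _ _] /andP[es _]; rewrite Dleaf // eT es.
  apply: (@exact_at_cone _ _ _ _ (@d_coef_d_coef G) (@hdeg_d G) (@qdeg_d G)
     _ Y0 Y1 (peel e D false) (unpeel e b D)).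
  + exact: convex_compl cX clS.
  + move=> s; rewrite SE /Y0 /Y1 -andb_orr.
    by case: (part _ _ _ _ _) => //=; case: (e \in edges_of s); case: (lab s _).
  + move=> s Ys; have Ds := DY0 s Ys; case/andP: Ys => Xs es.
    rewrite /Y1 edges_peel in_toggle eqxx /= es /= (lab_peel uD vD) // uD andbT.
    case/and3P: (Xs) => bs _ _.
    rewrite (part_agree P fZ DK pD _ bs (agree_peel uD vD false Ds)) //.
    by rewrite edges_peel bE.
  + move=> s Ys; have Ds := DY1 s Ys; case/andP: Ys => Xs /andP[es _].
    rewrite /Y0 edges_unpeel in_toggle eqxx /= es andbT.
    case/and3P: (Xs) => bs _ _.
    rewrite -(part_agree P fZ DK pD bs _ (agree_unpeel uD vD Ds)) //.
    by rewrite edges_unpeel bE.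
  + by move=> s Ys; rewrite (peelK uD vD) // DY0.
  + move=> s Ys; have Ds := DY1 s Ys; case/andP: Ys => _ /andP[_ /negbTE ls].
    by rewrite -[false]ls (unpeelK uD vD).
  + move=> s Ys; have Ds := DY0 s Ys; case/andP: Ys => _ es.
    rewrite (d_coef_edge es) ?edges_peel //.
    rewrite (edge_coef_into_leaf uD vD) ?edges_peel ?toggleK //; last first.
      by rewrite (lab_peel uD vD) // uD.
    by rewrite (agree_peel uD vD) // mulr1 sqr_sgn.
  + move=> s t /andP[_ es] Yt; have Dt := DY1 t Yt; case/andP: Yt => _ /andP[et lt].
    case/(coef_step es et) => est; rewrite (edge_coef_into_leaf uD vD) //; last first.
      by rewrite est toggleK.
    case ag: (agree _ _ _) => // _; apply: (agree_peelE uD vD) => //.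
      by rewrite est toggleK.
    exact: negbTE.
apply: IHn => //; first exact: leq_trans (free_e1 eF) len.
- by rewrite subUset sub1set e1.
- exact: fZ1 inD.
- exists (toggle e T); last by rewrite KZ'.
  by rewrite btw_e1 bE // in_toggle eqxx eT.
move=> A bA KA; have [bA' eA] := inD A bA; rewrite KZ' in KA.
have := crit _ (bE _ bA') (regrow A bA' eA KA).
have Ae : e \in A by move: bA; rewrite btw_e1 => /andP[].
by rewrite /toggle Ae cardZ' (cardsD1 e A) Ae cardsU1 nDP value_plus.
Qed.

End Parts.

(** * The width *)

Section Width.

Variable G : ribbonGraph.

Local Notation edge := 'I_(nedges G).
Implicit Types (A B : {set edge}).

Variable p : corner G.

Definition quasi_tree A := [set: corner G] \in bcomps A.

Lemma quasi_treeE A : quasi_tree A -> bcomps A = [set setT].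
Proof.
move=> TA; have eT c : orb A c = setT.
  by move: TA; rewrite /quasi_tree (bcompsE _ (in_setT c)) => /eqP.
apply/setP=> C; rewrite inE; apply/bcompsP/eqP=> [[c ->]|->]; first exact: eT.
by exists p.
Qed.

(** Toggling the edges of A, or those of its complement, changes the number of
    boundary components by at most one each time. *)
Lemma quasi_tree_card A : quasi_tree A ->
  (#|vertex G| <= #|A|.+1 /\ #|A| + #|bcomps [set: edge]| <= (nedges G).+1)%N.
Proof.
move=> /quasi_treeE e1; have b1 : #|bcomps A| = 1%N by rewrite e1 cards1.
have := card_bcomps_le A set0; rewrite b1 card_bcomps0.
have -> : [set i | (i \in A) (+) (i \in set0)] = A.
  by apply/setP=> i; rewrite !inE addbF.
have := card_bcomps_le A setT; rewrite b1.
have -> : [set i | (i \in A) (+) (i \in setT)] = ~: A.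
  by apply/setP=> i; rewrite !inE addbT.
by have := cardsC A; rewrite card_ord; lia.
Qed.

(** The whole reduced complex is the case of the full interval with nothing
    frozen. *)
Lemma reduced_Kh_quasi_tree i j : connected G -> reduced_Kh_neq0 p i j ->
  exists2 A, quasi_tree A & j - i - i = - #|A|%:Z.
Proof.
move=> conG [x [rx dx] nb].
have [/existsP[A /andP[qA /eqP eA]]|] :=
  boolP [exists A, quasi_tree A && (j - i - i == - #|A|%:Z)]; first by exists A.
rewrite negb_exists => /forallP no; case: nb.
have cov0 : ~: cover (set0 : {set {set corner G}}) = setT.
  by rewrite /cover big_set0 setC0.
have btwT A : btw set0 setT A by rewrite /btw sub0set subsetT.
have partE s : part p set0 setT set0 set0 s = ~~ lab s p.
  by rewrite /part btwT setI0 eqxx.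
have ex : exact_states (part p set0 setT set0 set0) i (j - 1).
  apply: exact_part; rewrite ?sub0set //.
  - by move=> A _; rewrite sub0set.
  - by rewrite -in_setC cov0 inE.
  - have [T bT] := exists_quasi_tree conG.
    by exists T; rewrite ?btwT // cov0 bT inE.
  - move=> A _; rewrite cov0 => qA; have := no A.
    by rewrite /quasi_tree qA /= subrK !cards0 addr0 subr0 sub0r.
have hx k (y : chain G) : reduced_chain p k j y <->
    homog (@hdeg G) (@qdeg G) (part p set0 setT set0 set0) k (j - 1) y.
  split=> h s /h[h1 h2 h3]; rewrite ?partE in h1 *; split=> //.
    by rewrite -h3 addrK.
  by rewrite h3 subrK.
case: (ex x) => [|t _|y hy dy].
- exact/hx.
- by have /ffunP/(_ t) := dx; rewrite !ffunE.
exists y; first exact/hx.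
apply/ffunP=> t; rewrite ffunE; have [Xt|nXt] := boolP (part p set0 setT set0 set0 t).
  exact: dy.
have -> : x t = 0.
  by apply/eqP; apply: contraNT nXt => /rx[h _ _]; rewrite partE.
apply: big1 => s _; apply/eqP; apply: contraNT nXt.
rewrite mulf_eq0 negb_or => /andP[/hy[Xs _ _] nd].
by rewrite !partE in Xs *; exact: lab_marked_d nd Xs.
Qed.

Lemma reduced_Kh_delta_quasi_tree delta : connected G ->
  reduced_Kh_delta_neq0 p delta ->
  exists2 A, quasi_tree A & delta = - (#|A|%:R / 2).
Proof.
move=> conG [i [j [-> nz]]]; have [A qA e] := reduced_Kh_quasi_tree conG nz.
exists A => //; have {e} : j%:~R - i%:~R - i%:~R = - #|A|%:R :> rat.
  by rewrite -!rmorphB /= e rmorphN.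
move=> e; have -> : j%:~R = - #|A|%:R + i%:~R + i%:~R :> rat by rewrite -e !subrK.
by field.
Qed.

Lemma n_comp_connected : connected G -> n_comp (@adjacent G) predT = 1%N.
Proof.
move=> conG; have /card_gt0P[v _] := vertex_gt0 G.
rewrite -(@n_comp_connect _ (@adjacent G) _ v); last by move=> x y; rewrite !conG.
by apply: eq_n_comp_r => w; rewrite [RHS]conG.
Qed.

Lemma quasi_tree_genus A B : connected G -> quasi_tree A -> quasi_tree B ->
  #|B|%:R / 2 - #|A|%:R / 2 <= genus G.
Proof.
move=> conG /quasi_tree_card[h1 _] /quasi_tree_card[_ h2].
rewrite /genus /euler_char n_comp_connected // -mulrBl ler_pM2r ?invr_gt0 //.
have {}h1 : #|vertex G|%:R <= #|A|%:R + 1 :> rat by rewrite natr1 ler_nat.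
have {}h2 : #|B|%:R + #|bcomps [set: edge]|%:R <= (nedges G)%:R + 1 :> rat.
  by rewrite natr1 -natrD ler_nat.
rewrite (_ : 1.*2 = 2)%N //.
by lra.
Qed.

End Width.

(** Only finitely many gradings - k / 2 can occur, so the extrema exist as soon as
    the homology is nonzero. *)
Lemma delta_extrema (G : ribbonGraph) (p : corner G) :
  (forall delta, reduced_Kh_delta_neq0 p delta ->
     exists2 A : {set 'I_(nedges G)}, quasi_tree A & delta = - (#|A|%:R / 2)) ->
  (exists delta, reduced_Kh_delta_neq0 p delta) ->
  is_delta_max p (delta_max p) /\ is_delta_min p (delta_min p).
Proof.
move=> qt [delta0 nz0].
pose N k := boolp.asbool (reduced_Kh_delta_neq0 p (- (k%:R / 2))).
have NP delta : reduced_Kh_delta_neq0 p delta ->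
    exists2 k, N k & delta = - (k%:R / 2) /\ (k <= nedges G)%N.
  move=> nz; have [A _ eA] := qt _ nz; exists #|A|; first by apply/boolp.asboolP; rewrite -eA.
  by split=> //; rewrite -[X in (_ <= X)%N]card_ord; exact: max_card.
have exN : exists k, N k by have [k Nk _] := NP _ nz0; exists k.
have bN k : N k -> (k <= nedges G)%N.
  move=> /boolp.asboolP/NP[k' _ [/oppr_inj e le]].
  have /eqP : k%:R = k'%:R :> rat by apply: (mulIf _ e); rewrite invr_eq0.
  by rewrite eqr_nat => /eqP->.
split.
  apply: classical_sets.xgetPex; case: (ex_minnP exN) => k Nk kmin.
  exists (- (k%:R / 2)); split; first exact/boolp.asboolP.
  move=> delta /NP[k' /kmin le [-> _]].
  by rewrite lerN2 ler_pM2r ?invr_gt0 // ler_nat.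
apply: classical_sets.xgetPex; case: (ex_maxnP exN bN) => k Nk kmax.
exists (- (k%:R / 2)); split; first exact/boolp.asboolP.
move=> delta /NP[k' /kmax le [-> _]].
by rewrite lerN2 ler_pM2r ?invr_gt0 // ler_nat.
Qed.

Theorem theorem1p3 (G : ribbonGraph) (p : corner G) :
  connected G -> hw p <= genus G + 1.
Proof.
move=> conG; have qt delta := @reduced_Kh_delta_quasi_tree G p delta conG.
rewrite /hw lerD2r.
have [nz|nz] := boolp.pselect (exists delta, reduced_Kh_delta_neq0 p delta).
  have [[/qt[A qA ->] _] [/qt[B qB ->] _]] := delta_extrema qt nz.
  by rewrite opprK addrC; exact: (quasi_tree_genus p).
have [T bT] := exists_quasi_tree conG.
have qT : quasi_tree T by rewrite /quasi_tree bT inE.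
rewrite /delta_max /delta_min !classical_sets.xgetPN; last 2 first.
- by move=> x [h _]; apply: nz; exists x.
- by move=> x [h _]; apply: nz; exists x.
by have := quasi_tree_genus p conG qT qT; rewrite !subrr.
Qed.
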